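(* Assume the Elliott–Halberstam conjecture. Then for every $c<e$, $H(p)>c\log_2 p$ for almost all primes $p$.
   Context: For positive integers $a,b$ write $a\prec b$ if $b\equiv 1\pmod a$. A prime chain (of length $k\ge 1$) is a sequence of primes $p_1\prec p_2\prec\cdots\prec p_k$. For a prime $p$, $H(p)$ is the length $k$ of the longest prime chain with $p_k=p$. Let $\pi(x;q,a)=|\{p\le x: p\text{ prime},\ p\equiv a\pmod q\}|$, $\mathrm{li}(x)=\int_2^x dt/\log t$, and let $\phi$ be Euler's function. The Elliott–Halberstam conjecture is the statement that for any fixed $\theta<1$ and $A>0$, $$\sum_{m\le x^\theta}\max_{2\le y\le x}\left|\pi(y;m,1)-\frac{\mathrm{li}(y)}{\phi(m)}\right|\ll_{\theta,A}\frac{x}{(\log x)^{A}}.$$ $\log_2 x=\log\log x$. A property holds for almost all primes if the number of primes $p\le x$ failing it is $o(x/\log x)$ as $x\to\infty$. *)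

(* Defs.v *)
(* Primes, congruences, counting and the totient are those of MathComp (on nat);
   real analysis is that of MathComp-Analysis, over an arbitrary realType. *)
From HB Require Import structures.
From mathcomp Require Import all_boot all_order all_algebra.
From mathcomp Require Import all_classical all_reals all_analysis.

Set Implicit Arguments.
Unset Strict Implicit.
Unset Printing Implicit Defensive.

Import Order.TTheory GRing.Theory Num.Theory.
Import numFieldNormedType.Exports.

Local Open Scope classical_set_scope.
Local Open Scope ring_scope.

Definition prec (a b : nat) : bool := (b == 1 %[mod a])%N.

Definition prime_chain (s : seq nat) : bool :=
  [&& s != [::], all prime s & sorted prec s].

Definition chain_to (p k : nat) : Prop :=
  exists s : seq nat, [/\ prime_chain s, size s = k & last 0%N s = p].

(* A prime chain is strictly increasing, so one ending at p has at most p
   terms: the restriction k <= p loses nothing (see [H_max]). If p is not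
   prime, no chain ends at p and H p = 0. *)
Definition H (p : nat) : nat := (\max_(k < p.+1 | `[< chain_to p k >]) k)%N.

Lemma prec_ltn a b : prime a -> prime b -> prec a b -> (a < b)%N.
Proof.
move=> pa pb; rewrite /prec (modn_small (prime_gt1 pa)) => /eqP e.
rewrite ltnNge; apply/negP; rewrite leq_eqVlt => /orP[/eqP eab|lt_ba].
  by move: e; rewrite eab modnn.
by move: e (prime_gt1 pb); rewrite modn_small // => ->.
Qed.

Lemma chain_to_le p k : chain_to p k -> (k <= p)%N.
Proof.
case=> -[|x s] [/and3P[// _ /= /andP[px ps] xs] <- <-] /=.
apply: (@leq_trans (x + size s)%N).
  by rewrite -add1n leq_add2r prime_gt0.
elim: s x px ps xs => [|y s IHs] x px /=; first by rewrite addn0.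
move=> /andP[py ps] /andP[xy ys]; apply: leq_trans (IHs y py ps ys).
by rewrite addnS -addSn leq_add2r prec_ltn.
Qed.

Lemma H_max p : prime p ->
  chain_to p (H p) /\ (forall k, chain_to p k -> (k <= H p)%N).
Proof.
move=> pp; have c1 : chain_to p 1.
  by exists [:: p]; rewrite /prime_chain /= pp.
have lt k : chain_to p k -> (k < p.+1)%N by move/chain_to_le.
split; last first.
  move=> k ck.
  by apply: (@leq_bigmax_cond _ _ _ (Ordinal (lt _ ck))); apply/asboolP.
rewrite /H (bigop.bigmax_eq_arg (Ordinal (lt _ c1))); last exact/asboolP.
by case: arg_maxnP => [|i /asboolP //]; apply/asboolP.
Qed.

Definition primes_le (R : realType) (x : R) (P : nat -> bool) : nat :=
  #|[set p : 'I_(Num.truncn x).+1 | prime p && P p]|.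

Definition primepi (R : realType) (x : R) (q a : nat) : nat :=
  primes_le x (fun p => p == a %[mod q])%N.

Definition li (R : realType) (x : R) : R :=
  \int[@lebesgue_measure R]_(t in `[2, x]) (ln t)^-1.

Definition EH_error (R : realType) (y : R) (m : nat) : R :=
  `|(primepi y m 1)%:R - li y / (totient m)%:R|.

(* A supremum, since over real y the maximum need not be attained: the prime
   count jumps. It is a genuine one when 2 <= x, see [EH_max_has_sup]. *)
Definition EH_max (R : realType) (x : R) (m : nat) : R :=
  sup [set EH_error y m | y in `[2, x]].

Definition ElliottHalberstam (R : realType) : Prop :=
  forall theta A : R, theta < 1 -> 0 < A ->
  exists C : R, \forall x \near +oo,
    \sum_(1 <= m < (Num.truncn (x `^ theta)).+1) EH_max x m
      <= C * (x / ln x `^ A).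

Definition almost_all_primes (R : realType) (P : nat -> Prop) : Prop :=
  (primes_le x (fun p => ~~ `[< P p >]))%:R / (x / ln x)
    @[x --> +oo] --> (0 : R).

Lemma li_bound (R : realType) (x y : R) : 2 <= y <= x ->
  0 <= li y <= (ln 2)^-1 * (x - 2).
Proof.
move=> /andP[y2 yx].
have ln2_gt0 : 0 < ln 2 :> R by rewrite ln_gt0// ltr1n.
have inln t : t \in `[2, y] -> 0 < (ln t)^-1 <= (ln 2)^-1.
  rewrite in_itv/= => /andP[t2 _]; have t0 : 0 < t by exact: lt_le_trans t2.
  have le_ln : ln 2 <= ln t by rewrite ler_ln// posrE.
  have lnt_gt0 : 0 < ln t by exact: lt_le_trans le_ln.
  by rewrite invr_gt0 lnt_gt0/= lef_pV2 ?posrE.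
apply/andP; split.
  by apply: Rintegral_ge0 => t /inln /andP[/ltW].
apply: (@le_trans _ _
  (\int[@lebesgue_measure R]_(t in `[2, y]) cst (ln 2)^-1 t)).
  apply: le_Rintegral => //.
  - apply: continuous_compact_integrable; first exact: segment_compact.
    apply: continuous_in_subspaceT => t /set_mem /=.
    rewrite in_itv/= => /andP[t2 _].
    apply: continuousV; first by rewrite gt_eqF// ln_gt0// (lt_le_trans _ t2)// ltr1n.
    by apply: continuous_ln; exact: lt_le_trans t2.
  - apply: continuous_compact_integrable; first exact: segment_compact.
    by apply: continuous_subspaceT => t; exact: cst_continuous.
  - by move=> t /inln /andP[].
rewrite Rintegral_cst//= lebesgue_measure_itv/= lte_fin.
have := y2; rewrite le_eqVlt => /orP[/eqP <-|->].
  by rewrite ltxx/= mulr0 mulr_ge0 ?subr_ge0 ?(le_trans y2)// invr_ge0 ltW.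
by rewrite -EFinB/= ler_pM2l ?invr_gt0// lerD2r.
Qed.

Lemma EH_max_has_sup (R : realType) (x : R) (m : nat) : 2 <= x ->
  has_sup [set EH_error y m | y in `[2, x]].
Proof.
move=> x2; split.
  by exists (EH_error 2 m), 2 => //=; rewrite in_itv/= lexx.
exists ((Num.truncn x).+1%:R + (ln 2)^-1 * (x - 2)) => _ [y /= + <-].
rewrite in_itv/= => /[dup] hy /andP[y2 yx].
have /andP[li0 lile] := li_bound hy.
apply: le_trans (ler_normB _ _) _; rewrite normr_nat lerD//.
  rewrite ler_nat; apply: leq_trans (max_card _) _.
  by rewrite card_ord ltnS le_truncn.
rewrite normrM (ger0_norm li0); apply: le_trans lile.
rewrite ler_piMr// normfV normr_nat.
by case: (totient m) => [|k]; rewrite ?invr0// invf_le1 ?ltr0n// ler1n.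
Qed.

(* Main.v *)
Require Import Defs.
From HB Require Import structures.
From mathcomp Require Import all_boot all_order all_algebra.
From mathcomp Require Import all_classical all_reals all_analysis.
From mathcomp Require Import zify ring lra.

Set Implicit Arguments.
Unset Strict Implicit.
Unset Printing Implicit Defensive.

Import Order.TTheory GRing.Theory Num.Theory.
Import numFieldNormedType.Exports.
Local Open Scope ring_scope.

(* Second moments give a lower bound for the density of the primes p for which
   p - 1 has a prime factor in a set S of primes lying in [x^d, x^th0]: with
   m = sum_(q in S) 1 / (q - 1) it is at least m / (1 + m) - o(1).  The pairs q, r
   in S with q r > x^theta are out of reach of the Elliott-Halberstam conjecture;
   they are rare because sum_(q | p - 1) ln q <= ln p bounds a full second moment
   by pi(x) (ln x)^2, and the pairs with q r <= x^theta already contribute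
   (theta^2 - o(1)) pi(x) (ln x)^2.

   In the scale u = ln ln x, let f_k(u) be the density of the primes p with
   H p >= k.  When f_k is small the bound above reads
   f_(k+1)(u) >= (1 - o(1)) int^u f_k, so from f_k >= eps on [v, +oo[ one gets
   f_(k+M)(v + M / c') >= eps (M / c')^M / M! up to small losses, which is at
   least eps when c' < e and M is large.  Iterating over blocks, H p >= k holds
   for a proportion at least eps of the primes up to x as soon as
   ln ln x >= u0 + k / c'.  Finally, taking for S the primes q <= x^(1/4) with
   H q >= c ln ln x makes m tend to infinity. *)

(** * Elementary prime sums *)

Lemma natr_primes_le (R : realType) (x : R) (P : nat -> bool) :
  (primes_le x P)%:R =
  \sum_(p < (Num.truncn x).+1 | prime p) (P p)%:R :> R.
Proof.
rewrite /primes_le -sum1_card natr_sum.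
rewrite (eq_bigl (fun p : 'I__ => prime p && P p)); last first.
  by move=> p; rewrite unfold_in; exact: asboolb.
by rewrite big_mkcondr /=; apply: eq_bigr => p _; case: (P p).
Qed.

Lemma primes_le_mono (R : realType) (x : R) (P Q : nat -> bool) :
  (forall p, prime p -> P p -> Q p) ->
  (primes_le x P)%:R <= (primes_le x Q)%:R :> R.
Proof.
move=> PQ; rewrite !natr_primes_le; apply: ler_sum => p pp.
by rewrite ler_nat; case: (P p) (PQ p pp) => // ->.
Qed.

Lemma primepi_eq (R : realType) (x : R) (m : nat) :
  (primepi x m 1)%:R =
  \sum_(p < (Num.truncn x).+1 | prime p) (p == 1 %[mod m])%N%:R :> R.
Proof. by rewrite /primepi natr_primes_le. Qed.

(** Symmetry of [c] exchanges the pairs above and below the diagonal. The full relation gives the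
    square of a sum; the other use is [q * r <= Q]. *)
Lemma sum_sym_pairs (R : comNzRingType) (n : nat) (P : pred nat) (c : rel nat)
    (f : nat -> R) : symmetric c ->
  \sum_(i < n | P i) \sum_(j < n | P j && c i j) f i * f j =
  \sum_(i < n | P i && c i i) f i ^+ 2 +
  (\sum_(i < n | P i) \sum_(j < n | [&& P j, (j < i)%N & c i j]) f i * f j) *+ 2.
Proof.
move=> csym.
have -> : \sum_(i < n | P i) \sum_(j < n | P j && c i j) f i * f j =
    \sum_(i < n | P i) ((if c i i then f i ^+ 2 else 0) +
      \sum_(j < n | [&& P j, (j < i)%N & c i j]) f i * f j +
      \sum_(j < n | [&& P j, (i < j)%N & c i j]) f i * f j).
  apply: eq_bigr => i Pi.
  rewrite (bigID (fun j : 'I_n => j == i)) /= -addrA; congr (_ + _).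
    rewrite big_mkcond /= (bigD1 i) //= eqxx Pi andbT expr2 big1 ?addr0 //.
    by move=> j /negbTE ->; rewrite andbF.
  rewrite (bigID (fun j : 'I_n => (j < i)%N)) /=; congr (_ + _);
    apply: eq_bigl => j; rewrite -!andbA; congr (_ && _);
    by rewrite -val_eqE /=; case: ltngtP; rewrite ?andbF ?andbT.
rewrite !big_split /= -addrA; congr (_ + _); first by rewrite -big_mkcondr.
rewrite mulr2n; congr (_ + _).
rewrite (exchange_big_dep (fun j : 'I_n => P j)) /=; last by move=> i j _ /andP[].
by apply: eq_bigr => i Pi; apply: eq_big => [j|j _]; rewrite ?Pi 1?mulrC // csym.
Qed.

Lemma sqr_sum (R : comNzRingType) (n : nat) (P : pred nat) (f : nat -> R) :
  (\sum_(i < n | P i) f i) ^+ 2 =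
  \sum_(i < n | P i) f i ^+ 2 +
  (\sum_(i < n | P i) \sum_(j < n | P j && (j < i)%N) f i * f j) *+ 2.
Proof.
have := @sum_sym_pairs R n P (fun _ _ => true) f (fun _ _ => erefl).
rewrite expr2 big_distrlr /=.
under eq_bigr => i _ do under eq_bigl => j do rewrite andbT.
move=> ->; congr (_ + _ *+ 2); first by apply: eq_bigl => i; rewrite andbT.
by apply: eq_bigr => i _; apply: eq_bigl => j; rewrite andbT.
Qed.

Lemma cong1_dvd q p : prime p -> (p == 1 %[mod q])%N = (q %| p.-1)%N.
Proof. by move=> pp; rewrite eqn_mod_dvd ?prime_gt0 // subn1. Qed.

Lemma prime_coprime_neq q r : prime q -> prime r -> (q < r)%N -> coprime q r.
Proof.
move=> pq pr ltqr; rewrite prime_coprime // dvdn_prime2 //.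
by rewrite neq_ltn ltqr.
Qed.

(** Logarithm of the prime factorization, by strong induction, dividing out the least prime factor
    of [m]. *)
Lemma sum_logn_ln (R : realType) (m n : nat) : (0 < m <= n)%N ->
  \sum_(q < n.+1 | prime q) (logn q m)%:R * ln q%:R = ln m%:R :> R.
Proof.
elim/ltn_ind: m => m IH /andP[m0 mn].
have [m1|m1] := leqP m 1.
  have -> : m = 1%N by lia.
  by rewrite ln1 big1 // => q _; rewrite logn1 mul0r.
pose r := pdiv m; have pr : prime r by exact: pdiv_prime.
have [k mE] := dvdnP (pdiv_dvd m); rewrite -/r in mE.
have k0 : (0 < k)%N by move: m0; rewrite mE muln_gt0 => /andP[].
have r0 := prime_gt0 pr; have r1 := prime_gt1 pr.
have km : (k < m)%N by rewrite mE -[X in (X < _)%N]muln1 ltn_pmul2l.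
have rn : (r < n.+1)%N by rewrite ltnS; apply: leq_trans mn; rewrite pdiv_leq.
rewrite mE natrM lnM ?posrE ?ltr0n // -(IH k) ?k0 /= ?(leq_trans (ltnW km)) //.
rewrite (bigD1 (Ordinal rn)) //= [in RHS](bigD1 (Ordinal rn)) //= addrAC.
rewrite lognM // [logn r r]logn_prime // eqxx natrD mulrDl mul1r.
congr (_ + _); apply: eq_bigr => q /andP[pq qr].
rewrite lognM // [logn q r]logn_prime //.
by rewrite (negbTE (qr : (q : nat) != r)) addn0.
Qed.

(* The square-free part of [p - 1] supported on primes up to [n] is at most [p]. *)
Lemma sum_ln_cong1 (R : realType) (n p : nat) : prime p ->
  \sum_(q < n.+1 | prime q) ln q%:R * (p == 1 %[mod q])%N%:R <= ln p%:R :> R.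
Proof.
move=> pp; have p1 := prime_gt1 pp.
have p10 : (0 < p.-1)%N by rewrite -ltnS prednK // ltnW.
have ln0 (q : nat) : 0 <= ln q%:R :> R.
  by case: q => [|q]; [rewrite ln0 | rewrite ln_ge0 // ler1n].
pose N := maxn n p.
apply: (@le_trans _ _ (\sum_(q < N.+1 | prime q) (logn q p.-1)%:R * ln q%:R)).
  have le : (n.+1 <= N.+1)%N by rewrite ltnS leq_maxl.
  rewrite (big_ord_widen_cond _ prime
    (fun q => ln q%:R * (p == 1 %[mod q])%N%:R) le) big_mkcondr /=.
  apply: ler_sum => q pq; case: ifP => _; last by rewrite mulr_ge0.
  rewrite cong1_dvd // mulrC ler_wpM2r // ler_nat.
  case: (boolP (_ %| _)%N) => // d.
  by rewrite logn_gt0 mem_primes pq p10 d.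
rewrite sum_logn_ln ?p10 /=; last by rewrite leq_max; apply/orP; right; lia.
rewrite ler_ln ?posrE ?ltr0n ?ler_nat; lia.
Qed.

Lemma logn_fact_bound (q n : nat) : prime q -> (q.-1 * logn q n`! <= n)%N.
Proof.
move=> pq; rewrite logn_fact //.
have q1 := prime_gt1 pq.
(* Legendre's formula is a sum of quotients [n %/ q ^ k]. Keeping [n %/ q ^ K] in the invariant
   closes the induction, since [q] copies of the next quotient are at most the current one. *)
suff h K : (q.-1 * (\sum_(1 <= k < K.+1) n %/ q ^ k) + n %/ q ^ K <= n)%N.
  exact: leq_trans (leq_addr _ _) (h n).
elim: K => [|K IH]; first by rewrite big_geq // muln0 expn0 divn1.
apply: leq_trans IH; rewrite big_nat_recr //= mulnDr -addnA leq_add2l.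
have -> : (n %/ q ^ K.+1 = (n %/ q ^ K) %/ q)%N.
  by rewrite expnSr divnMA.
set b := (n %/ _)%N.
have := leq_divM b q; have := q1.
by case: (q) => // k; rewrite mulnS /=; lia.
Qed.

(** Weak Stirling bound: passing from [n] to [n + 1] costs only [n * ln (1 + 1 / n) <= 1]. *)
Lemma ln_fact_ge (R : realType) (n : nat) :
  n%:R * ln n%:R - n%:R <= ln n`!%:R :> R.
Proof.
elim: n => [|n IH]; first by rewrite mul0r subr0 fact0 ln1.
rewrite factS natrM lnM ?posrE ?ltr0n ?fact_gt0 //.
case: n IH => [|n] IH; first by rewrite fact0 ln1; lra.
have n0 : 0 < n.+1%:R :> R by rewrite ltr0n.
have n1 : 0 < n.+2%:R :> R by rewrite ltr0n.
have e : n.+2%:R = n.+1%:R * (1 + n.+1%:R^-1) :> R.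
  by rewrite mulrDr mulfV ?gt_eqF // mulr1 -natr1.
have l : n.+1%:R * ln (1 + n.+1%:R^-1) <= 1 :> R.
  rewrite -[leRHS](@mulfV _ n.+1%:R) ?gt_eqF // ler_wpM2l ?ler0n //.
  by rewrite le_ln1Dx // (@lt_trans _ _ 0) ?invr_gt0 // ltrN10.
have p : 0 < 1 + n.+1%:R^-1 :> R by rewrite addr_gt0 ?invr_gt0.
have E : ln n.+2%:R = ln n.+1%:R + ln (1 + n.+1%:R^-1) :> R.
  by rewrite [in LHS]e lnM ?posrE.
move: IH l; rewrite E; set a := ln n.+1%:R; set b := ln _; set f := ln _.
rewrite -[n.+2]addn1 natrD; set z := n.+1%:R; nra.
Qed.

(* Mertens' lower bound, read off from the prime factorization of [n!]. *)
Lemma mertens_ge (R : realType) (n : nat) :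
  ln n%:R - 1 <= \sum_(q < n.+1 | prime q) ln q%:R / q.-1%:R :> R.
Proof.
case: n => [|n].
  rewrite ln0 // big1 ?sub0r ?lerN10 // => q pq.
  by move: (ltn_ord q) (prime_gt1 pq); lia.
have n0 : 0 < n.+1%:R :> R by rewrite ltr0n.
rewrite -(ler_pM2l n0) mulrBr mulr1; apply: le_trans (ln_fact_ge R n.+1) _.
rewrite -(@sum_logn_ln R n.+1`! n.+1`!) ?fact_gt0 ?leqnn //.
rewrite mulr_sumr.
(* The logarithm of the factorial is expanded over all primes up to the factorial itself. This range
   contains that of the right-hand side, and its further primes contribute 0. *)
have le : (n.+2 <= n.+1`!.+1)%N.
  by rewrite ltnS; elim: (n) => // k IH; rewrite factS (leq_pmulr k.+2 (fact_gt0 _)).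
rewrite (big_ord_widen_cond _ prime
    (fun q => n.+1%:R * (ln q%:R / q.-1%:R)) le) [leRHS]big_mkcondr /=.
apply: ler_sum => q pq; case: ifP => [_|].
  have q1 : 0 < q.-1%:R :> R by rewrite ltr0n; have := prime_gt1 pq; lia.
  have lq : 0 <= ln q%:R :> R by rewrite ln_ge0 // ler1n prime_gt0.
  rewrite mulrA mulrAC ler_wpM2r // ler_pdivlMr // -natrM ler_nat mulnC.
  exact: logn_fact_bound.
move=> /negbT; rewrite -leqNgt => qn.
rewrite (_ : logn q n.+1`! = 0%N) ?mul0r //.
rewrite logn_fact // big_nat big1 // => k /andP[k0 _].
by rewrite divn_small // (leq_trans qn) // -{1}[q : nat]expn1 leq_exp2l ?prime_gt1.
Qed.

(** * Moments of the number of prime factors of [p - 1] *)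

(** The off-diagonal part of the second moment whose moduli exceed the level [Q]. The weight is 1 in
    the sieve and [ln] in the bound for these pairs. *)
Definition bad_pairs (R : realType) (x : R) (Q : nat) (P : pred nat)
    (s : nat -> R) : R :=
  \sum_(q < Q.+1 | P q) \sum_(r < Q.+1 | [&& P r, (r < q)%N & (Q < q * r)%N])
    s q * s r * (primepi x (q * r) 1)%:R.

Lemma primepi_EH (R : realType) (x : R) (m : nat) :
  li x / (totient m)%:R - EH_error x m <= (primepi x m 1)%:R
    <= li x / (totient m)%:R + EH_error x m.
Proof. by rewrite /EH_error; case: ler0P => ?; apply/andP; split; lra. Qed.

(** Unique factorization: for primes [r < q] the product determines the pair, so no modulus is
    counted twice. *)
Lemma sum_pairs_le (R : realType) (Q : nat) (P : pred nat) (F : nat -> R) :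
  (forall q, P q -> prime q) -> (forall m, 0 <= F m) ->
  \sum_(q < Q.+1 | P q)
    \sum_(r < Q.+1 | [&& P r, (r < q)%N & (q * r <= Q)%N]) F (q * r)%N
  <= \sum_(1 <= m < Q.+1) F m.
Proof.
move=> Ppr F0.
rewrite pair_big_dep /=.
pose D := [set u : 'I_Q.+1 * 'I_Q.+1 |
  P u.1 && [&& P u.2, (u.2 < u.1)%N & (u.1 * u.2 <= Q)%N]]%SET.
pose h (u : 'I_Q.+1 * 'I_Q.+1) : 'I_Q.+1 := inord (u.1 * u.2).
have hE u : u \in D -> h u = (u.1 * u.2)%N :> nat.
  by rewrite inE => /andP[_ /and3P[_ _ le]]; rewrite inordK.
have prD u : u \in D -> [/\ prime u.1, prime u.2 & (u.2 < u.1)%N].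
  by rewrite inE => /andP[/Ppr ? /and3P[/Ppr ? ? _]].
have hinj : {in D &, injective h}.
  move=> [a b] [c d] uD vD /(congr1 val); rewrite /= !hE //=.
  have [/= pa pb ltab] := prD _ uD; have [/= pc pd ltcd] := prD _ vD.
  move=> e; have : (b %| c * d)%N by rewrite -e dvdn_mull.
  rewrite Euclid_dvdM // !dvdn_prime2 // => /orP[/eqP bc|/eqP bd]; last first.
    have := e; rewrite bd => /eqP; rewrite eqn_pmul2r ?prime_gt0 // => /eqP ac.
    by congr pair; exact: val_inj.
  move: e; rewrite bc mulnC => /eqP; rewrite eqn_pmul2l ?prime_gt0 // => /eqP ad.
  by move: ltab ltcd; rewrite bc ad; lia.
rewrite (eq_bigl (mem D)); last by move=> u; rewrite /= inE.
rewrite (eq_bigr (fun u => F (h u))); last by move=> u uD; rewrite hE.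
rewrite -(@big_imset _ _ _ _ _ h D (fun i => F i)) //=.
rewrite (big_nat_widenl 1 0) // big_mkord [leRHS]big_mkcond /= big_mkcond /=.
apply: ler_sum => m _; case: ifP => [/imsetP[u uD ->]|_]; last by case: ifP.
rewrite hE // ifT // muln_gt0; have [/prime_gt0 -> /prime_gt0 -> _] := prD _ uD.
by [].
Qed.

Lemma sum_primes_le (R : realType) (Q : nat) (P : pred nat) (F : nat -> R) :
  (forall q, P q -> prime q) -> (forall m, 0 <= F m) ->
  \sum_(q < Q.+1 | P q) F q <= \sum_(1 <= m < Q.+1) F m.
Proof.
move=> Ppr F0; rewrite (big_nat_widenl 1 0) // big_mkord.
rewrite [leRHS]big_mkcond /= big_mkcond /=; apply: ler_sum => m _.
by case: ifP => [/Ppr /prime_gt0 ->|_]; last case: ifP.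
Qed.

Lemma first_moment (R : realType) (x : R) (n : nat) (P : pred nat)
    (s : nat -> R) :
  \sum_(p < (Num.truncn x).+1 | prime p)
    \sum_(q < n | P q) s q * (p == 1 %[mod q])%N%:R
  = \sum_(q < n | P q) s q * (primepi x q 1)%:R.
Proof.
rewrite exchange_big /=; apply: eq_bigr => q _.
by rewrite primepi_eq mulr_sumr.
Qed.

(** For distinct primes [q] and [r] the Chinese remainder theorem merges the two congruences into
    one modulo [q * r]. *)
Lemma second_moment (R : realType) (x : R) (Q : nat) (P : pred nat)
    (s : nat -> R) : (forall q, P q -> prime q) ->
  \sum_(p < (Num.truncn x).+1 | prime p)
    (\sum_(q < Q.+1 | P q) s q * (p == 1 %[mod q])%N%:R) ^+ 2
  = \sum_(q < Q.+1 | P q) s q ^+ 2 * (primepi x q 1)%:R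
  + (\sum_(q < Q.+1 | P q)
      \sum_(r < Q.+1 | [&& P r, (r < q)%N & (q * r <= Q)%N])
      s q * s r * (primepi x (q * r) 1)%:R) *+ 2
  + bad_pairs x Q P s *+ 2.
Proof.
move=> Ppr; rewrite -addrA -mulrnDl.
under eq_bigr => p _ do
  rewrite (sqr_sum _ _ (fun q => s q * ((p : nat) == 1 %[mod q])%N%:R)).
rewrite big_split /= sumrMnl; congr (_ + _ *+ 2).
  rewrite exchange_big /=; apply: eq_bigr => q _.
  rewrite primepi_eq mulr_sumr; apply: eq_bigr => p _.
  by rewrite exprMn; case: (_ == _)%N; rewrite ?expr1n // expr0n.
rewrite exchange_big /= /bad_pairs -big_split /=; apply: eq_bigr => q Pq.
rewrite exchange_big /=.
rewrite (bigID (fun r : 'I__ => (q * r <= Q)%N)) /=.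
have E (r : 'I_Q.+1) : P r -> (r < q)%N ->
  \sum_(p < (Num.truncn x).+1 | prime p)
    s q * (p == 1 %[mod q])%N%:R * (s r * (p == 1 %[mod r])%N%:R) =
  s q * s r * (primepi x (q * r) 1)%:R.
  move=> Pr ltrq; rewrite primepi_eq mulr_sumr; apply: eq_bigr => p _.
  rewrite chinese_remainder; last first.
    by rewrite coprime_sym prime_coprime_neq // Ppr.
  by rewrite mulrACA -natrM mulnb.
congr (_ + _); apply: eq_big => r; rewrite ?andbA -?ltnNge //;
  by move=> /andP[/andP[Pr rq] _]; exact: E.
Qed.

Lemma EH_error_ge0 (R : realType) (x : R) (m : nat) : 0 <= EH_error x m.
Proof. exact: normr_ge0. Qed.

Lemma ln_nat_ge0 (R : realType) (n : nat) : 0 <= ln n%:R :> R.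
Proof. by case: n => [|n]; [rewrite ln0 | rewrite ln_ge0 // ler1n]. Qed.

Lemma bad_pairs_ge0 (R : realType) (x : R) (Q : nat) (P : pred nat)
    (s : nat -> R) : (forall q, P q -> 0 <= s q) -> 0 <= bad_pairs x Q P s.
Proof.
move=> s0; apply: sumr_ge0 => q Pq; apply: sumr_ge0 => r /andP[Pr _].
by rewrite !mulr_ge0 // s0.
Qed.

(** Let [N p] count the [q] in [S] dividing [p - 1]. As [(1 - t N)^2 >= 0], the indicator of
    [N p > 0] is at least [2 t N - t^2 N^2]. Up to errors and bad pairs, the first moment is
    [li x * m] and the second at most [li x * (m + m^2)]; the best [t] is [1 / (1 + m)]. Two of the
    five error sums come from the first moment, three from the second. *)
Lemma sieve_ge (R : realType) (x : R) (Q : nat) (S : pred nat) (m : R) :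
  (forall q, S q -> prime q) -> 0 <= li x ->
  m = \sum_(q < Q.+1 | S q) q.-1%:R^-1 ->
  li x * (m / (1 + m)) - 5 * (\sum_(1 <= k < Q.+1) EH_error x k)
    - 2 * bad_pairs x Q S (fun=> 1)
  <= (primes_le x (fun p => [exists q : 'I_Q.+1, S q && (p == 1 %[mod q])%N]))%:R.
Proof.
move=> Spr li0 mE; set E := \sum_(1 <= k < Q.+1) _; set B := bad_pairs _ _ _ _.
have m0 : 0 <= m by rewrite mE; apply: sumr_ge0 => q _; rewrite invr_ge0.
have m1 : 0 < 1 + m by lra.
pose t := (1 + m)^-1.
have t0 : 0 <= t by rewrite invr_ge0 ltW.
have tm : t * (1 + m) = 1 by rewrite mulVf ?gt_eqF.
pose N (p : nat) : R := \sum_(q < Q.+1 | S q) 1 * (p == 1 %[mod q])%N%:R.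
have B0 : 0 <= B by apply: bad_pairs_ge0.
have E0 : 0 <= E by apply: sumr_ge0 => k _; exact: EH_error_ge0.
have E1 : \sum_(q < Q.+1 | S q) EH_error x q <= E.
  by apply: sum_primes_le => // k; exact: EH_error_ge0.
have E2 : \sum_(q < Q.+1 | S q)
    \sum_(r < Q.+1 | [&& S r, (r < q)%N & (q * r <= Q)%N]) EH_error x (q * r)
    <= E.
  by apply: sum_pairs_le => // k; exact: EH_error_ge0.
have M1 := first_moment x Q.+1 S (fun=> 1); rewrite -/(N _) in M1.
have M2 := @second_moment R x Q S (fun=> 1) Spr.
rewrite -/B in M2.
have C1 : li x * m - E <= \sum_(q < Q.+1 | S q) 1 * (primepi x q 1)%:R
    <= li x * m + E.
  rewrite mE mulr_sumr; apply/andP; split.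
    apply: le_trans (lerB (lexx _) E1) _; rewrite -sumrB; apply: ler_sum => q Sq.
    rewrite mul1r; have /andP[+ _] := primepi_EH x q.
    by rewrite totient_prime // Spr.
  apply: le_trans (lerD (lexx _) E1); rewrite -big_split; apply: ler_sum => q Sq.
  rewrite mul1r; have /andP[_] := primepi_EH x q.
  by rewrite totient_prime // Spr.
(* Dropping the constraint [q * r <= Q] and then adding the diagonal completes the main term to
   [m ^+ 2]. *)
have C2 : (\sum_(q < Q.+1 | S q)
      \sum_(r < Q.+1 | [&& S r, (r < q)%N & (q * r <= Q)%N])
      1 * 1 * (primepi x (q * r) 1)%:R) *+ 2 <= li x * m ^+ 2 + 2 * E.
  rewrite -[leLHS]mulr_natl -[2 * E]/(2 * E).
  apply: (@le_trans _ _ (2 * (li x * \sum_(q < Q.+1 | S q)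
      \sum_(r < Q.+1 | S r && (r < q)%N) q.-1%:R^-1 * r.-1%:R^-1 + E))).
    rewrite ler_pM2l //; apply: le_trans (lerD (lexx _) E2).
    rewrite mulr_sumr -big_split; apply: ler_sum => q Sq /=.
    apply: (@le_trans _ _ (\sum_(r < Q.+1 | [&& S r, (r < q)%N & (q * r <= Q)%N])
      (li x * (q.-1%:R^-1 * r.-1%:R^-1) + EH_error x (q * r)))).
      apply: ler_sum => r /and3P[Sr rq _]; rewrite !mul1r.
      have /andP[_] := primepi_EH x (q * r)%N.
      rewrite totient_coprime; last first.
        by rewrite coprime_sym prime_coprime_neq // Spr.
      by rewrite !totient_prime ?Spr // natrM invfM.
    rewrite big_split lerD2r mulr_sumr /= big_mkcond [leRHS]big_mkcond /=.
    apply: ler_sum => r _; case: ifP => [/and3P[-> -> _] //|_].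
    by case: ifP => // _; rewrite !mulr_ge0 // invr_ge0.
  rewrite mulrDr lerD2r mE (sqr_sum _ S (fun q => q.-1%:R^-1)).
  rewrite mulrDr mulrCA -[leLHS]add0r lerD //; last by rewrite mulr_natl.
  by rewrite mulr_ge0 // sumr_ge0 // => q _; rewrite sqr_ge0.
rewrite natr_primes_le.
apply: (@le_trans _ _ (\sum_(p < (Num.truncn x).+1 | prime p)
    (2 * t * N p - t ^+ 2 * N p ^+ 2))); last first.
  apply: ler_sum => p pp; case: existsP => [_|nex] /=.
    by have := sqr_ge0 (1 - t * N p); lra.
  rewrite (_ : N p = 0) ?mulr0 ?expr0n /= ?mulr0 ?subr0 //.
  apply: big1 => q Sq; case: eqP => e; last by rewrite mulr0.
  by case: nex; exists q; rewrite Sq e eqxx.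
rewrite sumrB -!mulr_sumr M1 M2.
move: C1 C2; set c1 := \sum_(q < Q.+1 | S q) 1 * _.
rewrite (_ : \sum_(q < Q.+1 | S q) 1 ^+ 2 * _ = c1); last first.
  by apply: eq_bigr => q _; rewrite expr1n.
set c2 := _ *+ 2 => /andP[C1l C1u] C2.
have -> : m / (1 + m) = m * t by [].
have t1 : t <= 1 by rewrite invf_le1 //; lra.
have tt : t ^+ 2 <= 1 by rewrite exprn_ile1.
have tt0 : 0 <= t ^+ 2 by rewrite exprn_ge0.
have -> : B *+ 2 = 2 * B by rewrite mulr_natl.
have H1 : t ^+ 2 * (c1 + c2 + 2 * B) <= t ^+ 2 * (li x * m + li x * m ^+ 2 + 3 * E + 2 * B).
  by rewrite ler_wpM2l //; lra.
have H2 : 2 * t * (li x * m - E) <= 2 * t * c1.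
  by rewrite ler_wpM2l //; lra.
have H3 : t ^+ 2 * (li x * m + li x * m ^+ 2) = li x * (m * t).
  rewrite -[RHS]mul1r -tm; ring.
have H4 : t * E <= 1 * E by rewrite ler_wpM2r.
have H5 : t ^+ 2 * E <= 1 * E by rewrite ler_wpM2r.
have H6 : t ^+ 2 * B <= 1 * B by rewrite ler_wpM2r.
lra.
Qed.

Lemma ln2_le1 (R : realType) : ln 2 <= 1 :> R.
Proof. by have := @le_ln1Dx R 1; apply; lra. Qed.

Lemma ln_pred_le1 (R : realType) (q : nat) : prime q ->
  0 <= (ln q%:R : R) / q.-1%:R <= 1.
Proof.
move=> /prime_gt1 q1; have q0 : 0 < q.-1%:R :> R by rewrite ltr0n; lia.
rewrite divr_ge0 ?ln_nat_ge0 //= ler_pdivrMr // mul1r.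
rewrite (_ : q%:R = 1 + q.-1%:R); last by rewrite nat1r prednK // ltnW.
by rewrite le_ln1Dx // (lt_trans _ q0) // ltrN10.
Qed.

(* Mertens' bound applied to each inner sum [\sum_(r <= Q / q) ln r / (r - 1)]:
   with the diagonal terms the left side is about [\sum_q (ln q + ln (Q / q))
   ln q / (q - 1)]. *)
Lemma log_pairs_ge (R : realType) (Q : nat) : 3 <= ln Q%:R :> R ->
  (ln Q%:R - 3) * (ln Q%:R - 1) <=
  \sum_(q < Q.+1 | prime q) ln q%:R ^+ 2 / q.-1%:R +
  (\sum_(q < Q.+1 | prime q)
      \sum_(r < Q.+1 | [&& prime r, (r < q)%N & (q * r <= Q)%N])
      (ln q%:R / q.-1%:R) * (ln r%:R / r.-1%:R)) *+ 2 :> R.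
Proof.
move=> lQ3; pose u (q : nat) : R := ln q%:R / q.-1%:R.
have Q0 : (0 < Q)%N by case: (Q) lQ3 => //; rewrite ln0 //; lra.
have u01 q : prime q -> 0 <= u q <= 1 by exact: ln_pred_le1.
pose c : rel nat := fun q r => (q * r <= Q)%N.
have csym : symmetric c by move=> q r; rewrite /c mulnC.
have := @sum_sym_pairs R Q.+1 prime c u csym; rewrite /c => E.
have diag : \sum_(q < Q.+1 | prime q && (q * q <= Q)%N) u q ^+ 2
    <= \sum_(q < Q.+1 | prime q) u q.
  rewrite big_mkcondr; apply: ler_sum => q /u01 /andP[u0 u1].
  by case: ifP => // _; rewrite expr2 ler_piMl.
have low : \sum_(q < Q.+1 | prime q) u q * (ln Q%:R - ln q%:R - 2) <=
   \sum_(q < Q.+1 | prime q) \sum_(r < Q.+1 | prime r && (q * r <= Q)%N) u q * u r.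
  apply: ler_sum => q pq; rewrite -mulr_sumr ler_wpM2l //.
    by have /andP[] := u01 q pq.
  have q0 := prime_gt0 pq; have qQ : (q <= Q)%N by rewrite -ltnS.
  have d0 : (0 < Q %/ q)%N by rewrite divn_gt0.
  have le : ((Q %/ q).+1 <= Q.+1)%N by rewrite ltnS leq_div.
  have -> : \sum_(r < Q.+1 | prime r && (q * r <= Q)%N) u r =
            \sum_(r < (Q %/ q).+1 | prime r) u r.
    rewrite (big_ord_widen_cond _ prime u le).
    by apply: eq_bigl => r; rewrite ltnS leq_divRL // mulnC.
  apply: le_trans (mertens_ge R _).
  (* As [Q %/ q >= 1], integer division loses at most a factor 2, and [ln 2 <= 1]. Together with the
     1 in Mertens' bound this is the constant 2 in [low]. *)
  have : ln Q%:R <= ln (2 * q%:R * (Q %/ q)%:R) :> R.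
    rewrite ler_ln ?posrE ?mulr_gt0 ?ltr0n // -!natrM ler_nat.
    by rewrite {1}(divn_eq Q q); have := ltn_pmod Q q0; nia.
  have := ln2_le1 R.
  by rewrite !lnM ?posrE ?mulr_gt0 ?ltr0n //; lra.
have M := mertens_ge R Q; rewrite -/u in M.
have sq : \sum_(q < Q.+1 | prime q) ln q%:R ^+ 2 / q.-1%:R =
    \sum_(q < Q.+1 | prime q) u q * ln q%:R.
  by apply: eq_bigr => q _; rewrite /u expr2 mulrAC.
rewrite sq -/u; rewrite E in low.
(* The terms in [ln q] cancel; the 3 is the 2 of [low] plus 1 for the diagonal. *)
have F : \sum_(q < Q.+1 | prime q) u q * (ln Q%:R - ln q%:R - 2) +
  \sum_(q < Q.+1 | prime q) u q * ln q%:R - \sum_(q < Q.+1 | prime q) u q =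
  (ln Q%:R - 3) * \sum_(q < Q.+1 | prime q) u q.
  rewrite -big_split -sumrB mulr_sumr; apply: eq_bigr => q _ /=; ring.
have G : (ln Q%:R - 3) * (ln Q%:R - 1) <=
    (ln Q%:R - 3) * \sum_(q < Q.+1 | prime q) u q.
  by rewrite ler_wpM2l // subr_ge0.
lra.
Qed.

(* [\sum_(q | p - 1) ln q <= ln x] bounds the full second moment of this sum by
   [pi(x) ln x ^ 2], and the diagonal and the pairs with [q r <= Q] already
   account for almost all of it. *)
Lemma bad_log_pairs_le (R : realType) (x : R) (Q : nat) :
  0 <= li x -> 1 <= x -> Q%:R <= x -> 3 <= ln Q%:R :> R ->
  2 * bad_pairs x Q prime (fun q => ln q%:R) <=
  li x * (ln x ^+ 2 - (ln Q%:R - 3) * (ln Q%:R - 1)) +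
  4 * (\sum_(1 <= k < Q.+1) EH_error x k) * ln x ^+ 2.
Proof.
move=> li0 x1 Qx lQ3; set E := \sum_(1 <= k < Q.+1) _; set B := bad_pairs _ _ _ _.
have Q0 : (0 < Q)%N by case: (Q) lQ3 => //; rewrite ln0 //; lra.
have x0 : 0 < x by lra.
have E0 : 0 <= E by apply: sumr_ge0 => k _; exact: EH_error_ge0.
have lx0 : 0 <= ln x by exact: ln_ge0.
have E1 : \sum_(q < Q.+1 | prime q) EH_error x q <= E.
  by apply: sum_primes_le => // k; exact: EH_error_ge0.
have E2 : \sum_(q < Q.+1 | prime q)
    \sum_(r < Q.+1 | [&& prime r, (r < q)%N & (q * r <= Q)%N]) EH_error x (q * r)
    <= E.
  by apply: sum_pairs_le => // k; exact: EH_error_ge0.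
(* The modulus 1 is among those of [E], so [E] also controls the total number of primes. *)
have Epi : (primepi x 1 1)%:R <= li x + E.
  have /andP[_] := primepi_EH x 1; rewrite (_ : totient 1 = 1%N) // divr1 => h.
  apply: (le_trans h); rewrite lerD2l /E big_ltn // lerDl.
  by apply: sumr_ge0 => k _; exact: EH_error_ge0.
have lq (q : nat) : prime q -> (q <= Q)%N -> 0 <= (ln q%:R : R) <= ln x.
  move=> pq qQ; rewrite ln_nat_ge0 ler_ln ?posrE ?ltr0n ?prime_gt0 //.
  by apply: le_trans Qx; rewrite ler_nat.
have M2 := @second_moment R x Q prime (fun q => ln q%:R) (fun _ => id).
rewrite -/B in M2.
(* Each inner sum is at most [ln p <= ln x]. Of the four errors [E * ln x ^+ 2] in the result, one
   arises here, one in [T1] and two in the doubled [T2]. *)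
have U : \sum_(p < (Num.truncn x).+1 | prime p)
    (\sum_(q < Q.+1 | prime q) ln q%:R * (p == 1 %[mod q])%N%:R) ^+ 2
    <= (li x + E) * ln x ^+ 2.
  apply: (@le_trans _ _ ((primepi x 1 1)%:R * ln x ^+ 2)); last first.
    by rewrite ler_wpM2r // exprn_ge0.
  rewrite primepi_eq mulr_suml; apply: ler_sum => p pp.
  rewrite !modn1 eqxx mul1r ler_pXn2r ?nnegrE //; last first.
    by apply: sumr_ge0 => q _; rewrite mulr_ge0 ?ln_nat_ge0.
  apply: le_trans (sum_ln_cong1 R Q pp) _.
  rewrite ler_ln ?posrE ?ltr0n ?prime_gt0 //.
  by rewrite -truncn_ge_nat ?ltW // -ltnS.
have T1 : li x * \sum_(q < Q.+1 | prime q) ln q%:R ^+ 2 / q.-1%:R -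
    ln x ^+ 2 * E <=
    \sum_(q < Q.+1 | prime q) ln q%:R ^+ 2 * (primepi x q 1)%:R.
  apply: le_trans (lerB (lexx _) (ler_wpM2l (exprn_ge0 _ lx0) E1)) _.
  rewrite !mulr_sumr -sumrB; apply: ler_sum => q pq.
  have /andP[l0 l1] := lq _ pq (ltn_ord q).
  have /andP[+ _] := primepi_EH x q; rewrite totient_prime // => h.
  apply: le_trans (ler_wpM2l (exprn_ge0 2 l0) h); rewrite mulrBr lerB //.
    by rewrite mulrCA.
  by rewrite ler_wpM2r ?EH_error_ge0 // ler_pXn2r ?nnegrE.
have T2 : li x * \sum_(q < Q.+1 | prime q)
      \sum_(r < Q.+1 | [&& prime r, (r < q)%N & (q * r <= Q)%N])
      (ln q%:R / q.-1%:R) * (ln r%:R / r.-1%:R) - ln x ^+ 2 * E <=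
    \sum_(q < Q.+1 | prime q)
      \sum_(r < Q.+1 | [&& prime r, (r < q)%N & (q * r <= Q)%N])
      ln q%:R * ln r%:R * (primepi x (q * r) 1)%:R.
  apply: le_trans (lerB (lexx _) (ler_wpM2l (exprn_ge0 _ lx0) E2)) _.
  rewrite !mulr_sumr -sumrB; apply: ler_sum => q pq.
  rewrite !mulr_sumr -sumrB; apply: ler_sum => r /and3P[pr rq _].
  have /andP[l0 l1] := lq _ pq (ltn_ord q).
  have /andP[k0 k1] := lq _ pr (ltn_ord r).
  have /andP[+ _] := primepi_EH x (q * r)%N.
  rewrite totient_coprime; last by rewrite coprime_sym prime_coprime_neq.
  rewrite !totient_prime // natrM invfM => h.
  apply: le_trans (ler_wpM2l (mulr_ge0 l0 k0) h); rewrite mulrBr lerB //.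
    by rewrite le_eqVlt; apply/orP; left; apply/eqP; ring.
  by rewrite ler_wpM2r ?EH_error_ge0 // expr2 ler_pM.
have V := log_pairs_ge lQ3; have V' := ler_wpM2l li0 V.
move: U T1 T2 V'; rewrite {}M2 {V Epi E1 E2}.
set a := \sum_(q < _ | prime q) (ln q%:R ^+ 2 * _).
set b := \sum_(q < _ | prime q) \sum_(r < _ | _) (_ * _ * (primepi _ _ _)%:R).
set a' := \sum_(q < _ | prime q) (ln q%:R ^+ 2 / _).
set b' := \sum_(q < _ | prime q) \sum_(r < _ | _) (_ * _).
move: a b a' b' E E0 B => a b a' b' E E0 B; rewrite !mulr2n; lra.
Qed.

(** * Bounds from the Elliott-Halberstam conjecture *)

Lemma ln2_ge (R : realType) : 1 / 2 <= ln 2 :> R.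
Proof.
have h : ln (1 + - (1 / 2)) <= - (1 / 2) :> R by apply: le_ln1Dx; lra.
have e : 1 + - (1 / 2) = 2^-1 :> R by field.
by move: h; rewrite e lnV ?posrE //; lra.
Qed.

Lemma integrable_ln_inv (R : realType) (a b : R) : 1 < a ->
  (@lebesgue_measure R).-integrable `[a, b] (EFin \o (fun t => (ln t)^-1)).
Proof.
move=> a1; apply: continuous_compact_integrable; first exact: segment_compact.
apply: continuous_in_subspaceT => t /set_mem /=.
rewrite in_itv/= => /andP[t2 _]; have t1 : 1 < t by exact: lt_le_trans t2.
apply: continuousV; first by rewrite gt_eqF // ln_gt0.
by apply: continuous_ln; exact: lt_trans t1.
Qed.

Lemma li_ge (R : realType) (x : R) : 2 < x -> (x - 2) / ln x <= li x.
Proof.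
move=> x2; have lx : 0 < ln x by rewrite ln_gt0 //; lra.
have -> : (x - 2) / ln x =
    \int[@lebesgue_measure R]_(t in `[2, x]) cst (ln x)^-1 t.
  rewrite Rintegral_cst //= lebesgue_measure_itv /= lte_fin x2 -EFinB /=.
  by rewrite mulrC.
apply: le_Rintegral => //.
- apply: continuous_compact_integrable; first exact: segment_compact.
  by apply: continuous_subspaceT => t; exact: cst_continuous.
- by apply: integrable_ln_inv; lra.
- move=> t /=; rewrite in_itv /= => /andP[t2 tx].
  have t0 : 0 < ln t by rewrite ln_gt0 //; lra.
  by rewrite lef_pV2 ?posrE // ler_ln ?posrE //; lra.
Qed.

Lemma li_ge0 (R : realType) (x : R) : 2 <= x -> 0 <= li x.
Proof.
move=> x2; have : 2 <= x <= x by rewrite x2 lexx.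
by move=> /li_bound /andP[].
Qed.

(** Split at [y = sqrt x]: below, the trivial bound [2 * y] suffices; above, the integrand is at
    most [1 / ln y = 2 / ln x]. Both are compared with [x / ln y]. *)
Lemma li_le (R : realType) (x : R) : 4 < x -> li x <= 6 * (x / ln x).
Proof.
move=> x4; pose y := Num.sqrt x.
have x0 : 0 < x by lra.
have yx : y ^+ 2 = x by rewrite sqr_sqrtr // ltW.
have y0 : 0 <= y by exact: sqrtr_ge0.
have y2 : 2 < y by nra.
have yltx : y < x by nra.
have ly : 0 < ln y by rewrite ln_gt0 //; lra.
have lx : ln x = 2 * ln y by rewrite -yx lnXn ?mulr_natl //; lra.
have I : li x - li y <= (x - y) / ln y.
  rewrite /li Rintegral_itvB ?bnd_simp //; [|apply: integrable_ln_inv; lra|lra|lra].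
  have -> : (x - y) / ln y =
      \int[@lebesgue_measure R]_(t in `]y, x]) cst (ln y)^-1 t.
    rewrite Rintegral_cst //= lebesgue_measure_itv /= lte_fin yltx -EFinB /=.
    by rewrite mulrC.
  have sub : (`]y, x] `<=` `[y, x])%classic.
    by move=> t /=; rewrite !in_itv /= => /andP[/ltW -> ->].
  have y1 : 1 < y by lra.
  have Ic : (@lebesgue_measure R).-integrable `[y, x] (EFin \o cst (ln y)^-1).
    apply: continuous_compact_integrable; first exact: segment_compact.
    by apply: continuous_subspaceT => t; exact: cst_continuous.
  apply: le_Rintegral => //.
  - by apply: integrableS (integrable_ln_inv x y1).
  - by apply: integrableS Ic.
  - move=> t /=; rewrite in_itv /= => /andP[ty tx].
    have t0 : 0 < ln t by rewrite ln_gt0 //; lra.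
    by rewrite lef_pV2 ?posrE // ler_ln ?posrE //; lra.
have B : li y <= 2 * y.
  have /andP[_ h] := @li_bound R y y (introT andP (conj (ltW y2) (lexx _))).
  apply: (le_trans h); rewrite -(ler_pM2l (_ : 0 < ln 2)); last first.
    by have := ln2_ge R; lra.
  rewrite mulrA mulfV ?mul1r; last by rewrite gt_eqF //; have := ln2_ge R; lra.
  by have := ln2_ge R; nra.
have lyy : ln y < y by apply: ln_sublinear; lra.
have E : x / ln x = x / ln y / 2 by rewrite lx; field; rewrite gt_eqF.
have J : y <= x / ln y by rewrite ler_pdivlMr //; nra.
have K : (x - y) / ln y <= x / ln y by rewrite ler_pM2r ?invr_gt0 //; lra.
by rewrite E; lra.
Qed.

Lemma near_ge_ln (R : realType) (M : R) : \forall x \near +oo, M <= ln x.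
Proof.
near=> x; have : expR M <= x by near: x; apply: nbhs_pinfty_ge; exact: num_real.
by move=> h; rewrite -(expRK M) ler_ln // ?posrE ?expR_gt0 // (lt_le_trans (expR_gt0 M)).
Unshelve. all: by end_near. Qed.

Lemma EH_error_le_max (R : realType) (x : R) (m : nat) : 2 <= x ->
  EH_error x m <= EH_max x m.
Proof.
move=> x2; apply: ub_le_sup; last by exists x => //=; rewrite in_itv /= x2 lexx.
by have [] := @EH_max_has_sup R x m x2.
Qed.

(** The conjecture at [A = 2] and [y = x]: the total error is smaller than [x / ln x] by a factor
    [ln x]. *)
Lemma EH_sum_le (R : realType) (theta : R) : ElliottHalberstam R -> theta < 1 ->
  exists2 C : R, 0 < C & \forall x \near +oo,
    \sum_(1 <= m < (Num.truncn (x `^ theta)).+1) EH_error x m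
      <= C * (x / ln x ^+ 2).
Proof.
move=> EH th1; have [C HC] := EH theta 2 th1 (ltr0n R 2).
exists (Num.max C 1); first by rewrite lt_max ltr01 orbT.
near=> x.
have x2 : 2 <= x by near: x; apply: nbhs_pinfty_ge; exact: num_real.
have lx1 : 1 <= ln x by near: x; exact: near_ge_ln.
apply: (@le_trans _ _ (C * (x / ln x ^+ 2))).
  rewrite -powR_mulrn; last by lra.
  apply: (@le_trans _ _
    (\sum_(1 <= m < (Num.truncn (x `^ theta)).+1) EH_max x m)).
    by apply: ler_sum => m _; exact: EH_error_le_max.
  by near: x; exact: HC.
rewrite ler_wpM2r ?le_max ?lexx // divr_ge0 ?exprn_ge0 //; lra.
Unshelve. all: by end_near. Qed.

Lemma sum_pred_le (R : realType) (n N : nat) (S T : pred nat) (F : nat -> R) :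
  (forall q, (q < n)%N -> S q -> T q && (q < N)%N) -> (forall q, 0 <= F q) ->
  \sum_(q < n | S q) F q <= \sum_(q < N | T q) F q.
Proof.
move=> STN F0; pose M := maxn n N.
rewrite (big_ord_widen_cond _ S F (leq_maxl n N)).
rewrite (big_ord_widen_cond _ T F (leq_maxr n N)).
rewrite [leLHS]big_mkcond [leRHS]big_mkcond /=; apply: ler_sum => q _.
case: ifP => [/andP[Sq qn]|_]; first by rewrite (STN _ qn Sq).
by case: ifP.
Qed.

Lemma div1D_mono (R : realType) (m M : R) : 0 <= m -> m <= M ->
  m / (1 + m) <= M / (1 + M).
Proof.
move=> m0 mM; rewrite ler_pdivrMr; last by lra.
rewrite mulrAC ler_pdivlMr; last by lra.
by nra.
Qed.

(** The bad pairs of [S] must be negligible. Each has [ln q * ln r >= (d * ln x) ^+ 2], so their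
    number is at most the log-weighted sum over all bad pairs of primes, divided by that square.
    This sum is small once the level [theta] is close enough to 1 in terms of [d] and [eta]. *)
Lemma sieve_step (R : realType) (d th0 eta : R) : ElliottHalberstam R ->
  0 < d -> th0 < 1 -> 0 < eta ->
  \forall x \near +oo, forall (S : pred nat) (n : nat) (m : R),
    (forall q, S q -> prime q && (d * ln x <= ln q%:R <= th0 * ln x)) ->
    0 <= m -> m <= \sum_(q < n | S q) q.-1%:R^-1 ->
    (m / (1 + m) - eta) * (x / ln x) <=
    (primes_le x (fun p => `[< exists2 q, S q & (p == 1 %[mod q])%N >]))%:R.
Proof.
move=> EH d0 th0_1 eta0.
have d2 : 0 < d ^+ 2 by rewrite exprn_gt0.
have de : 0 < d ^+ 2 * eta by rewrite mulr_gt0.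
(* Chosen so that [1 - th ^+ 2 <= 2 * del <= d ^+ 2 * eta / 8], the first half of the loss allowed
   in [quad]; the lower bound [48 / (d ^+ 2 * eta)] on [ln x] pays for the linear terms. *)
pose del := Num.min (1 / 2) (d ^+ 2 * eta / 16).
have del0 : 0 < del by rewrite lt_min; apply/andP; split; lra.
have del1 : del <= 1 / 2 by rewrite ge_min lexx.
have del2 : del <= d ^+ 2 * eta / 16 by rewrite ge_min lexx orbT.
pose th := Num.max th0 (1 - del).
have th1 : th < 1 by rewrite gt_max th0_1 /=; lra.
have thdel : 1 - del <= th by rewrite le_max lexx orbT.
have th0_th : th0 <= th by rewrite le_max lexx.
have [C C0 HC] := EH_sum_le EH th1.
near=> x => S n m HS m0 mle.
have x4 : 4 < x.
  have : 5 <= x by near: x; apply: nbhs_pinfty_ge; exact: num_real.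
  lra.
have xeta : 8 / eta <= x by near: x; apply: nbhs_pinfty_ge; exact: num_real.
have L8 : 8 <= ln x by near: x; exact: near_ge_ln.
have Ld : 48 / (d ^+ 2 * eta) <= ln x by near: x; exact: near_ge_ln.
have LC : 4 * (5 + 4 / d ^+ 2) * C / eta <= ln x by near: x; exact: near_ge_ln.
have EC : \sum_(1 <= m < (Num.truncn (x `^ th)).+1) EH_error x m
      <= C * (x / ln x ^+ 2) by near: x; exact: HC.
move: EC; set Q := Num.truncn _; set E := \sum_(1 <= _ < _) _ => EC.
set L := ln x in L8 Ld LC EC HS *.
have x0 : 0 < x by lra.
have L0 : 0 < L by lra.
have lny : ln (x `^ th) = th * L by rewrite ln_powR.
have y0 : 0 < x `^ th by exact: powR_gt0.
have y1 : 1 <= x `^ th.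
  rewrite -ler_ln ?posrE // ln1 lny; apply: mulr_ge0; last exact: ltW.
  by move: thdel del1; clear; lra.
have Qy : Q%:R <= x `^ th by rewrite truncn_le ltW.
have Q0 : (0 < Q)%N by rewrite truncn_gt0.
have Qx : Q%:R <= x.
  apply: (le_trans Qy); rewrite -ler_ln ?posrE // lny.
  by apply: ler_piMl; exact: ltW.
have lQ : th * L - 1 <= ln Q%:R.
  have : ln (x `^ th) <= ln (2 * Q%:R).
    rewrite ler_ln ?posrE // ?mulr_gt0 ?ltr0n //; apply: ltW.
    apply: lt_le_trans (truncnS_gt (x `^ th)) _.
    rewrite -/Q -natr1; have : 1 <= Q%:R :> R by rewrite ler1n.
    lra.
  rewrite lny lnM ?posrE ?ltr0n //; have := ln2_le1 R; lra.
have thL : 4 <= th * L by nra.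
have lQ3 : 3 <= (ln Q%:R : R) by lra.
have SQ q : S q -> (q < Q.+1)%N.
  move=> /HS /and3P[pq _ le]; rewrite ltnS truncn_ge_nat; last exact: ltW.
  rewrite -ler_ln ?posrE ?ltr0n ?prime_gt0 // lny (le_trans le) //.
  by rewrite ler_wpM2r // ltW.
have Spr q : S q -> prime q by move=> /HS /andP[].
have li0 : 0 <= li x by apply: li_ge0; lra.
have x1 : 1 <= x by lra.
pose M : R := \sum_(q < Q.+1 | S q) q.-1%:R^-1.
have mM : m <= M.
  apply: (le_trans mle).
  apply: (@sum_pred_le _ _ _ S S (fun q => q.-1%:R^-1)) => q.
    by move=> _ Sq; rewrite Sq SQ.
  by rewrite invr_ge0.
have G := @sieve_ge R x Q S M Spr li0 erefl; rewrite -/E in G.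
have B := @bad_log_pairs_le R x Q li0 x1 Qx lQ3; rewrite -/E -/L in B.
move: G B; set B1 := bad_pairs _ _ _ _; set Bl := bad_pairs _ _ _ _ => G B.
have BB : B1 * (d * L) ^+ 2 <= Bl.
  rewrite /B1 /Bl /bad_pairs mulr_suml [leLHS]big_mkcond [leRHS]big_mkcond.
  apply: ler_sum => q _; case Sq: (S q); last first.
    case: ifP => // _; apply: sumr_ge0 => r _.
    by rewrite !mulr_ge0 ?ln_nat_ge0.
  rewrite Spr // mulr_suml [leLHS]big_mkcond [leRHS]big_mkcond.
  apply: ler_sum => r _; case Sr: (S r) => /=; last first.
    by case: ifP => // _; rewrite !mulr_ge0 ?ln_nat_ge0.
  rewrite Spr //=; case: ifP => // _; rewrite !mul1r mulrC ler_wpM2r //.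
  have /and3P[_ lq _] := HS _ Sq; have /and3P[_ lr _] := HS _ Sr.
  by rewrite expr2 ler_pM // mulr_ge0 // ltW.
have E0 : 0 <= E by apply: sumr_ge0 => k _; exact: EH_error_ge0.
set X := x / L; have X0 : 0 < X by rewrite divr_gt0.
have EX : (5 + 4 / d ^+ 2) * E <= eta / 4 * X.
  have p : 0 < 5 + 4 / d ^+ 2 by rewrite addr_gt0 // divr_gt0.
  apply: (le_trans (ler_wpM2l (ltW p) EC)).
  have -> : x / L ^+ 2 = X / L by rewrite /X expr2 invfM mulrA.
  move: LC; rewrite ler_pdivrMr // => LC.
  rewrite mulrA mulrA ler_pdivrMr // mulrAC.
  by rewrite mulrA ler_wpM2r ?(ltW X0) //; move: LC; clear; lra.
have quad : L ^+ 2 - (ln Q%:R - 3) * (ln Q%:R - 1) <= d ^+ 2 * eta / 4 * L ^+ 2.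
  have h1 : (th * L - 4) * (th * L - 2) <= (ln Q%:R - 3) * (ln Q%:R - 1).
    by move: lQ thL; clear => lQ thL; apply: ler_pM; lra.
  have h2 : 1 - th ^+ 2 <= d ^+ 2 * eta / 8.
    by move: thdel del2 th1; clear; nra.
  have h3 : 6 * L <= d ^+ 2 * eta / 8 * L ^+ 2.
    move: Ld; rewrite ler_pdivrMr // => Ld.
    have : 48 * L <= L * (d ^+ 2 * eta) * L by rewrite ler_wpM2r // ltW.
    by rewrite expr2; clear; lra.
  have h4 := ler_wpM2r (exprn_ge0 2 (ltW L0)) h2.
  have h5 : th * L <= 1 * L by rewrite ler_wpM2r // ltW.
  move: h1 h3 h4 h5 L0; move: (_ * (ln Q%:R - 1)) (d ^+ 2 * eta) => a b; clear; nra.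
have B2 : 2 * B1 <= eta / 4 * li x + 4 / d ^+ 2 * E.
  have p : 0 < (d * L) ^+ 2 by rewrite exprn_gt0 // mulr_gt0.
  rewrite -(ler_pM2r p).
  have q1 := ler_wpM2l li0 quad.
  have -> : (eta / 4 * li x + 4 / d ^+ 2 * E) * (d * L) ^+ 2 =
    li x * (d ^+ 2 * eta / 4 * L ^+ 2) + 4 * E * L ^+ 2.
    by rewrite exprMn; field; rewrite gt_eqF.
  move: B BB q1; clear.
  move: (li x * _) (li x * _) (4 * E * _) ((d * L) ^+ 2) => a b f g; lra.
set c := (primes_le _ _)%:R in G; set cc := (primes_le _ _)%:R.
have ccc : c <= cc.
  apply: primes_le_mono => p pp /existsP[q /andP[Sq e]].
  by apply/asboolP; exists q.
have mu := div1D_mono m0 mM.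
have M1 : M / (1 + M) <= 1.
  have M0 : 0 <= M by exact: le_trans mM.
  by move: M0; clear => M0; rewrite ler_pdivrMr; lra.
move: mu M1; set mu := M / _; set mu' := m / _ => mu_le mu1; rewrite -/mu in G.
(* If [mu' <= eta] the left-hand side is nonpositive. Otherwise [mu - eta / 4] is positive and may
   multiply the lower bound for [li x]. *)
have [small|big] := leP mu' eta.
  apply: (@le_trans _ _ 0); last exact: ler0n.
  by rewrite mulr_le0_ge0 ?subr_le0 // ltW.
have lix : X - 2 / L <= li x.
  by apply: le_trans (li_ge _); [rewrite /X mulrBl|move: x4; clear; lra].
have eX : 2 / L <= eta / 4 * X.
  rewrite /X mulrA ler_wpM2r ?invr_ge0 ?(ltW L0) //.
  by move: xeta; rewrite ler_pdivrMr //; clear; lra.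
have L20 : 0 <= 2 / L by rewrite divr_ge0 ?ltW.
have k1 := ler_wpM2r (_ : 0 <= mu - eta / 4) lix.
have {}k1 : (X - 2 / L) * (mu - eta / 4) <= li x * (mu - eta / 4).
  by apply: k1; move: mu_le big eta0; clear; lra.
have k2 : 2 / L * (mu - eta / 4) <= 2 / L * 1 by rewrite ler_wpM2l //; move: mu1 eta0; clear; lra.
have k3 : (mu' - eta) * X <= (mu - eta) * X by rewrite ler_wpM2r ?(ltW X0) //; move: mu_le; clear; lra.
have k4 : 0 <= eta / 4 * X.
  by apply: mulr_ge0; [move: eta0; clear; lra|exact: ltW].
move: B2 EX G ccc eX k1 k2 k3 k4; clear.
move: X (2 / L) mu mu' (4 / d ^+ 2) (li x) E B1 c cc.
move=> X l mu mu' dd y E B c cc; lra.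
Unshelve. all: by end_near. Qed.

(** * Partial summation over windows *)

Lemma near_pinfty_ex (R : realType) (P : R -> Prop) :
  (\forall x \near +oo, P x) -> exists x0, forall x, x0 <= x -> P x.
Proof.
by move=> [M [_ HM]]; exists (M + 1) => x Mx; apply: HM; lra.
Qed.

Lemma primes_le_pi (R : realType) (x : R) (P : nat -> bool) :
  (primes_le x P)%:R <= (primepi x 1 1)%:R :> R.
Proof. by apply: primes_le_mono => p _ _; rewrite !modn1. Qed.

(** At [theta = 0] only the modulus 1 remains, and the conjecture becomes a prime number theorem
    with error [O(x / ln x ^+ 2)]. *)
Lemma primepi_EH1 (R : realType) : ElliottHalberstam R ->
  exists2 C : R, 0 < C & \forall x \near +oo,
    li x - C * (x / ln x ^+ 2) <= (primepi x 1 1)%:R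
      <= li x + C * (x / ln x ^+ 2).
Proof.
move=> EH; have [C C0 HC] := @EH_sum_le R 0 EH (@ltr01 R).
exists C => //; near=> x.
have : \sum_(1 <= m < (Num.truncn (x `^ 0)).+1) EH_error x m
      <= C * (x / ln x ^+ 2) by near: x; exact: HC.
rewrite powRr0 truncn1 big_nat1 => h.
have /andP[] := primepi_EH x 1; rewrite (_ : totient 1 = 1%N) // divr1.
by move=> a b; apply/andP; split; lra.
Unshelve. all: by end_near. Qed.

Lemma primepi_le (R : realType) : ElliottHalberstam R ->
  \forall x \near +oo, (primepi x 1 1)%:R <= 7 * (x / ln x) :> R.
Proof.
move=> EH; have [C C0 HC] := primepi_EH1 EH.
near=> x.
have x5 : 5 <= x by near: x; apply: nbhs_pinfty_ge; exact: num_real.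
have LC : C <= ln x by near: x; exact: near_ge_ln.
have /andP[_ h] : li x - C * (x / ln x ^+ 2) <= (primepi x 1 1)%:R
      <= li x + C * (x / ln x ^+ 2) by near: x; exact: HC.
have L0 : 0 < ln x by lra.
have l : li x <= 6 * (x / ln x) by apply: li_le; lra.
have xL : 0 <= x / ln x by rewrite divr_ge0 // ltW //; lra.
have e : C * (x / ln x ^+ 2) <= x / ln x.
  have -> : C * (x / ln x ^+ 2) = C / ln x * (x / ln x) by field; rewrite gt_eqF.
  by rewrite ler_piMl // ler_pdivrMr // mul1r.
lra.
Unshelve. all: by end_near. Qed.

Lemma lnln_addr_le (R : realType) (t h : R) : 1 < t -> 0 <= h ->
  ln (ln (t + h)) <= ln (ln t) + h / (t * ln t).
Proof.
move=> t1 h0; have t0 : 0 < t by lra.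
have lt0 : 0 < ln t by rewrite ln_gt0.
have E (a b : R) : 0 < a -> 0 <= b -> ln (a + b) <= ln a + b / a.
  move=> a0 b0; have -> : a + b = a * (1 + b / a) by field; rewrite gt_eqF.
  have ba : 0 <= b / a by rewrite divr_ge0 // ltW.
  rewrite lnM ?posrE //; last by lra.
  by rewrite lerD2l le_ln1Dx //; lra.
have th : ln (t + h) <= ln t + h / t by apply: E.
apply: (@le_trans _ _ (ln (ln t + h / t))).
  rewrite ler_ln ?posrE // ?ln_gt0; try lra.
  by rewrite ltr_wpDr // divr_ge0 // ltW.
apply: le_trans (E _ _ lt0 _) _; first by rewrite divr_ge0 // ltW.
by rewrite invfM mulrA.
Qed.

(* Partial summation: [sum 1/(q - 1) - G(Z) / Z], with [G] the counting function,
   increases by exactly [G(Z + 1) / (Z (Z + 1))] at each step. *)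
Lemma window_nat (R : realType) (P : pred nat) (g : R) (Y Z : nat) :
  (1 < Y <= Z)%N -> 0 <= g ->
  (forall n : nat, (Y < n <= Z)%N ->
    g * (n%:R / ln n%:R) <= \sum_(p < n.+1 | P p) 1) ->
  g * (ln (ln Z.+1%:R) - ln (ln Y.+1%:R)) <=
  \sum_(q < Z.+1 | P q && (Y < q)%N) q.-1%:R^-1
  + (\sum_(p < Y.+1 | P p) 1) / Y%:R.
Proof.
move=> /andP[Y1 YZ] g0 HG; pose G (n : nat) : R := \sum_(p < n.+1 | P p) 1.
have Y0 : 0 < Y%:R :> R by rewrite ltr0n; lia.
(* The induction carries both boundary terms; [G Z / Z] is nonnegative and is discarded only at the
   end. *)
suff : g * (ln (ln Z.+1%:R) - ln (ln Y.+1%:R)) <=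
    \sum_(q < Z.+1 | P q && (Y < q)%N) q.-1%:R^-1 - G Z / Z%:R + G Y / Y%:R.
  have : 0 <= G Z / Z%:R by rewrite divr_ge0 // sumr_ge0.
  rewrite -/(G Y); lra.
elim: Z YZ HG => [|Z IH] YZ HG; first by lia.
move: YZ; rewrite leq_eqVlt => /orP[/eqP <-|YZ].
  rewrite subrr mulr0 subrK sumr_ge0 // => q _; by rewrite invr_ge0.
have {}IH := IH YZ (fun n nZ => HG n (ltac:(lia))).
have HZ := HG Z.+1 (ltac:(lia)).
have GS : G Z.+1 = G Z + (P Z.+1)%:R.
  rewrite /G big_mkcond big_ord_recr -big_mkcond /=; congr (_ + _).
  by case: (P _).
rewrite big_mkcond big_ord_recr -big_mkcond /= (_ : (Y < Z.+1)%N) // andbT.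
rewrite -/(G Z.+1) in HZ.
have Z0 : 0 < Z%:R :> R by rewrite ltr0n; lia.
have Z10 : 0 < Z.+1%:R :> R by rewrite ltr0n.
have lZ0 : 0 < ln Z.+1%:R :> R by rewrite ln_gt0 // ltr1n; lia.
have step : ln (ln Z.+2%:R) <= ln (ln Z.+1%:R) + 1 / (Z.+1%:R * ln Z.+1%:R) :> R.
  by rewrite -[Z.+2]addn1 natrD; apply: lnln_addr_le; rewrite ?ltr1n //; lia.
(* The increment of the partial summation dominates that of [g * ln ln], since
   [1 / Z >= 1 / (Z + 1)]. *)
have inc : g * (1 / (Z.+1%:R * ln Z.+1%:R)) <= G Z.+1 / (Z%:R * Z.+1%:R).
  rewrite ler_pdivlMr ?mulr_gt0 //.
  apply: le_trans HZ; rewrite -mulrA ler_wpM2l //.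
  rewrite mul1r invfM mulrC -!mulrA mulVKf ?gt_eqF //.
  rewrite mulrC mulrC ler_wpM2r ?invr_ge0 ?(ltW lZ0) // ler_nat; lia.
have e : (if P Z.+1 then Z%:R^-1 else 0) = (P Z.+1)%:R / Z%:R :> R.
  by case: (P _); rewrite ?mul1r ?mul0r.
have e2 : G Z.+1 / (Z%:R * Z.+1%:R) = G Z.+1 / Z%:R - G Z.+1 / Z.+1%:R.
  by rewrite -[in RHS](natr1 Z); field; rewrite natr1 !gt_eqF.
rewrite e; move: inc IH (ler_wpM2l g0 step); rewrite e2 GS.
move: (ln (ln Z.+2%:R)) (ln (ln Z.+1%:R)) (ln (ln Y.+1%:R)) (1 / _) (G Y / _).
move: (Z%:R^-1) (Z.+1%:R^-1) (G Z) ((P Z.+1)%:R).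
move=> i i1 a p u v w s t; move: (\sum_(q < _ | _) _) => S; nra.
Qed.


(** Apply [window_nat] between the integer parts. The boundary term is at most [14 / ln y], because
    [primepi y 1 1 <= 7 * (y / ln y)] and [Y >= y / 2]; rounding [y] up costs [1 / (y * ln y)]. The
    threshold for [y] depends on [eta] alone, so the bound is uniform in [z], [g] and [P]. *)
Lemma window (R : realType) (eta : R) : ElliottHalberstam R -> 0 < eta ->
  \forall y \near +oo, forall (z g : R) (P : pred nat) (N : nat),
    y <= z -> z < N%:R -> 0 <= g <= 1 ->
    (forall t, y <= t <= z -> g * (t / ln t) <= (primes_le t P)%:R) ->
    g * (ln (ln z) - ln (ln y)) - eta <=
    \sum_(q < N | [&& prime q, P q & y < q%:R <= z]) q.-1%:R^-1.
Proof.
move=> EH eta0; near=> y => z g P N yz zN /andP[g0 g1] HP.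
have y8 : 8 <= y by near: y; apply: nbhs_pinfty_ge; exact: num_real.
have ye : 2 / eta <= y by near: y; apply: nbhs_pinfty_ge; exact: num_real.
have L1 : 1 <= ln y by near: y; exact: near_ge_ln.
have Le : 28 / eta <= ln y by near: y; exact: near_ge_ln.
have piy : (primepi y 1 1)%:R <= 7 * (y / ln y) :> R.
  by near: y; exact: primepi_le.
pose Y := Num.truncn y; pose Z := Num.truncn z.
have y0 : 0 <= y by lra.
have z0 : 0 <= z by lra.
have /andP[Yy yY] : Y%:R <= y < Y.+1%:R by exact: truncn_itv.
have /andP[Zz zZ] : Z%:R <= z < Z.+1%:R by exact: truncn_itv.
have Y1 : (1 < Y)%N by rewrite truncn_ge_nat //; lra.
have YZ : (Y <= Z)%N by exact: le_truncn.
have cnt (t : R) : (primes_le t P)%:R =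
    \sum_(p < (Num.truncn t).+1 | prime p && P p) 1 :> R.
  rewrite natr_primes_le [RHS]big_mkcondr /=.
  by apply: eq_bigr => p _; case: (P p).
have W : g * (ln (ln Z.+1%:R) - ln (ln Y.+1%:R)) <=
    \sum_(q < Z.+1 | prime q && P q && (Y < q)%N) q.-1%:R^-1
    + (\sum_(p < Y.+1 | prime p && P p) 1) / Y%:R.
  apply: (@window_nat R (fun p => prime p && P p)); rewrite ?Y1 //.
  move=> n /andP[Yn nZ].
  have ny : y <= n%:R by apply: le_trans (ltW yY) _; rewrite ler_nat.
  have nz : n%:R <= z by apply: le_trans Zz; rewrite ler_nat.
  by have := HP n%:R; rewrite cnt natrK; apply; rewrite ny nz.
have S : \sum_(q < Z.+1 | prime q && P q && (Y < q)%N) q.-1%:R^-1 <=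
    \sum_(q < N | [&& prime q, P q & y < q%:R <= z]) q.-1%:R^-1 :> R.
  apply: (@sum_pred_le R Z.+1 N (fun q => prime q && P q && (Y < q)%N)
    (fun q => [&& prime q, P q & y < q%:R <= z]) (fun q => q.-1%:R^-1)) => q.
    rewrite ltnS => qZ /andP[/andP[-> ->] Yq] /=.
    have qz : q%:R <= z by apply: le_trans Zz; rewrite ler_nat.
    rewrite qz andbT (lt_le_trans yY) ?ler_nat //=.
    by rewrite -(ltr_nat R) (le_lt_trans qz).
  by rewrite invr_ge0.
have Y0 : 0 < Y%:R :> R by rewrite ltr0n ltnW.
have y2Y : y <= 2 * Y%:R.
  have : 1 <= Y%:R :> R by rewrite ler1n ltnW.
  by move: yY; rewrite -natr1; lra.
have low : (\sum_(p < Y.+1 | prime p && P p) 1) / Y%:R <= eta / 2.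
  rewrite -cnt ler_pdivrMr //; apply: le_trans (primes_le_pi y P) _.
  apply: (le_trans piy); rewrite mulrA ler_pdivrMr; last by lra.
  apply: (@le_trans _ _ (eta / 2 * (y / 2) * ln y)); last first.
    by rewrite ler_wpM2r //; [lra|rewrite ler_wpM2l //; lra].
  move: Le; rewrite ler_pdivrMr // => Le.
  have -> : 7 * y = 28 * (y / 4) by field.
  have -> : eta / 2 * (y / 2) * ln y = (ln y * eta) * (y / 4) by field.
  by rewrite ler_wpM2r //; lra.
have lY : ln (ln Y.+1%:R) <= ln (ln y) + eta / 2.
  have YR : Y.+1%:R <= y + 1 by rewrite -natr1 lerD2r.
  apply: (@le_trans _ _ (ln (ln (y + 1)))).
    have a : ln Y.+1%:R <= ln (y + 1) by rewrite ler_ln ?posrE ?ltr0n //; lra.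
    by rewrite ler_ln ?posrE // ln_gt0 ?ltr1n ?ltnS ?(ltnW Y1) //; lra.
  apply: le_trans (@lnln_addr_le R y 1 _ ler01) _; first by lra.
  rewrite lerD2l ler_pdivrMr; last by rewrite mulr_gt0; lra.
  move: ye; rewrite ler_pdivrMr // => ye.
  have : y * eta * 1 <= y * eta * ln y by rewrite ler_wpM2l //; lra.
  lra.
have lZ : ln (ln z) <= ln (ln Z.+1%:R).
  have lz : 0 < ln z by rewrite ln_gt0 //; lra.
  have a : ln z <= ln Z.+1%:R by rewrite ler_ln ?posrE ?ltr0n ?ltW //; lra.
  by rewrite ler_ln ?posrE //; lra.
have k1 : g * (ln (ln z) - ln (ln y) - eta / 2) <=
    g * (ln (ln Z.+1%:R) - ln (ln Y.+1%:R)) by rewrite ler_wpM2l //; lra.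
have k2 : g * eta <= 1 * eta by rewrite ler_wpM2r // ltW.
lra.
Unshelve. all: by end_near. Qed.

(** * Propagation of a positive proportion *)

Lemma H_step (p q k : nat) : prime p -> prime q -> (p == 1 %[mod q])%N ->
  (k <= H q)%N -> (k < H p)%N.
Proof.
move=> pp pq qp kH; have [[s [/and3P[s0 sp so] sz sl]] _] := H_max pq.
have [_ Hp] := H_max pp; apply: leq_ltn_trans kH _; apply: Hp.
exists (rcons s p); split; last by rewrite last_rcons.
  rewrite /prime_chain all_rcons pp sp -size_eq0 size_rcons /=.
  by case: s s0 sl so {sp sz} => //= a s _ sl so; rewrite rcons_path so sl.
by rewrite size_rcons sz.
Qed.

Lemma level_step (R : realType) (d th0 eta : R) : ElliottHalberstam R ->
  0 < d -> th0 < 1 -> 0 < eta ->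
  \forall x \near +oo, forall (k n : nat) (m : R),
    0 <= m ->
    m <= \sum_(q < n | [&& prime q, (k <= H q)%N &
                        d * ln x <= ln q%:R <= th0 * ln x]) q.-1%:R^-1 ->
    (m / (1 + m) - eta) * (x / ln x) <=
    (primes_le x (fun p => k < H p)%N)%:R.
Proof.
move=> EH d0 th1 eta0; near=> x => k n m m0 mle.
have st : forall (S : pred nat) (n : nat) (m : R),
    (forall q, S q -> prime q && (d * ln x <= ln q%:R <= th0 * ln x)) ->
    0 <= m -> m <= \sum_(q < n | S q) q.-1%:R^-1 ->
    (m / (1 + m) - eta) * (x / ln x) <=
    (primes_le x (fun p => `[< exists2 q, S q & (p == 1 %[mod q])%N >]))%:R.
  by near: x; exact: sieve_step.
pose S : pred nat := fun q => [&& prime q, (k <= H q)%N &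
                        d * ln x <= ln q%:R <= th0 * ln x].
apply: le_trans (st S n m _ m0 mle) _.
  by move=> q /and3P[-> _ ->].
apply: primes_le_mono => p pp /asboolP[q /and3P[pq kH _] e].
exact: H_step e kH.
Unshelve. all: by end_near. Qed.

(** Inverse of [ln ln], giving access to the scale [u = ln ln x]: a shift of [u] by [tau] multiplies
    [ln x] by [expR tau]. *)
Definition dexp (R : realType) (u : R) : R := expR (expR u).

Lemma dexp_gt1 (R : realType) (u : R) : 1 < dexp u.
Proof. by rewrite /dexp expR_gt1 expR_gt0. Qed.

Lemma ln_dexp (R : realType) (u : R) : ln (dexp u) = expR u.
Proof. exact: expRK. Qed.

Lemma dexpK (R : realType) (u : R) : ln (ln (dexp u)) = u.
Proof. by rewrite ln_dexp expRK. Qed.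

Lemma ler_dexp (R : realType) (u v : R) : (dexp u <= dexp v) = (u <= v).
Proof. by rewrite /dexp !ler_expR. Qed.

Lemma lnK_dexp (R : realType) (t : R) : 1 < t -> dexp (ln (ln t)) = t.
Proof.
by move=> t1; rewrite /dexp lnK ?posrE ?ln_gt0 // lnK // posrE; lra.
Qed.

Lemma dexp_ge_ex (R : realType) (M : R) : exists u, forall v, u <= v -> M <= dexp v.
Proof.
exists M => v Mv; apply: le_trans Mv _.
have h (w : R) : w <= expR w by have := @expR_ge1Dx R w; lra.
exact: le_trans (h v) (h (expR v)).
Qed.

Opaque dexp.

(** Hockey-stick identity, the discrete form of integrating [u^j / j!]. Truncated subtraction is
    harmless: it makes both sides vanish for [i <= j], except in trivial cases with [j = 0]. *)
Lemma sum_bin_diag (i j : nat) :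
  (\sum_(l < i) 'C(l - j, j) = 'C(i - j, j.+1))%N.
Proof.
elim: i => [|i IH]; first by rewrite big_ord0 sub0n bin0n.
rewrite big_ord_recr /= IH.
have [ij|ij] := leqP j i; first by rewrite subSn // binS.
have -> : (i.+1 - j = 0)%N by lia.
have -> : (i - j = 0)%N by lia.
by rewrite !bin0n; case: (j) ij.
Qed.

(** A lower Riemann sum: the density is bounded below by a step function on consecutive windows of
    length [tau] in the scale [ln ln], and each window costs [eta]. *)
Lemma windows (R : realType) (eta : R) : ElliottHalberstam R -> 0 < eta ->
  exists v0, forall (v tau : R) (P : pred nat) (N : nat) (g : nat -> R) (n : nat),
    v0 <= v -> 0 < tau -> dexp (v + n%:R * tau) < N%:R ->
    (forall l, (l < n)%N -> 0 <= g l <= 1) ->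
    (forall l t, (l < n)%N ->
      dexp (v + l%:R * tau) <= t <= dexp (v + l.+1%:R * tau) ->
      g l * (t / ln t) <= (primes_le t P)%:R) ->
    \sum_(l < n) (g l * tau - eta) <=
    \sum_(q < N | [&& prime q, P q & dexp v < q%:R <= dexp (v + n%:R * tau)])
      q.-1%:R^-1.
Proof.
move=> EH eta0; have [y0 Hy] := near_pinfty_ex (window EH eta0).
have [v0 Hv] := dexp_ge_ex y0.
exists v0 => v tau P N g n vv tau0; elim: n => [|n IH] nN g01 HP.
  by rewrite big_ord0 sumr_ge0 // => q _; rewrite invr_ge0.
have e : n.+1%:R * tau = n%:R * tau + tau by rewrite -natr1 mulrDl mul1r.
have nt0 : 0 <= n%:R * tau by rewrite mulr_ge0 // ltW.
have le_n : dexp (v + n%:R * tau) <= dexp (v + n.+1%:R * tau).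
  by rewrite ler_dexp e; move: tau0; clear; lra.
have {}IH := IH (le_lt_trans le_n nN) (fun l ln => g01 l (ltnW ln))
  (fun l t ln => HP l t (ltnW ln)).
have W := Hy (dexp (v + n%:R * tau)) _ (dexp (v + n.+1%:R * tau)) (g n) P N
  le_n nN (g01 n (ltnSn n)) (fun t => HP n t (ltnSn n)).
have yn : y0 <= dexp (v + n%:R * tau) by apply: Hv; rewrite (le_trans vv) // lerDl.
have {}W := W yn; rewrite !dexpK in W.
rewrite big_ord_recr /=.
rewrite (bigID (fun q : 'I_N => q%:R <= dexp (v + n%:R * tau))) /=.
apply: lerD.
  apply: (le_trans IH); rewrite le_eqVlt; apply/orP; left; apply/eqP.
  apply: eq_bigl => q; rewrite -!andbA; do 3! congr (_ && _).
  case: (boolP (q%:R <= dexp (v + n%:R * tau))) => [h|]; last by rewrite andbF.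
  by rewrite (le_trans h le_n).
have -> : g n * tau = g n * (v + n.+1%:R * tau - (v + n%:R * tau)).
  by congr (_ * _); rewrite e; ring.
apply: (le_trans W); rewrite le_eqVlt; apply/orP; left; apply/eqP.
apply: eq_bigl => q; rewrite -!andbA -ltNge; do 2! congr (_ && _).
rewrite andbCA andbC; case: (boolP (dexp (v + n%:R * tau) < _)); rewrite ?andbF //.
move=> h; rewrite andbT.
have hv : dexp v < q%:R by apply: le_lt_trans h; rewrite ler_dexp lerDl.
by rewrite hv !andbT.
Qed.

(** The gap [tau - lam = 4 * kap] is shared out: one [kap] already reduces [tau] in [m], two pay for
    [m ^+ 2] in [m / (1 + m) >= m - m ^+ 2], and one pays for [eta]. *)
Lemma block_arith (R : realType) (tau lam kap A eta : R) :
  0 < lam -> lam < tau -> kap = (tau - lam) / 4 -> 0 <= A ->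
  2 * tau ^+ 2 * A <= tau - lam -> eta <= kap * A ->
  lam * A <= (tau - kap) * A / (1 + (tau - kap) * A) - eta.
Proof.
move=> lam0 lt kE A0 small etale.
have k0 : 0 < kap by rewrite kE; lra.
have kt : kap < tau by rewrite kE; lra.
set m := (tau - kap) * A.
have m0 : 0 <= m by rewrite mulr_ge0 //; lra.
have h : m - m ^+ 2 <= m / (1 + m).
  rewrite ler_pdivlMr; last by lra.
  have : 0 <= m * (m * m) by apply: mulr_ge0 => //; exact: mulr_ge0.
  by rewrite expr2; lra.
have m2 : m ^+ 2 <= 2 * kap * A.
  have a : m <= tau * A by rewrite ler_wpM2r //; lra.
  have b : m ^+ 2 <= (tau * A) ^+ 2 by rewrite !expr2 ler_pM.
  apply: (le_trans b).
  have -> : (tau * A) ^+ 2 = (2 * tau ^+ 2 * A) / 2 * A by field.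
  by rewrite ler_wpM2r //; rewrite kE; lra.
have -> : lam * A = (tau - kap) * A - 2 * kap * A - kap * A by rewrite kE; field.
by rewrite -/m; lra.
Qed.

(** Discrete form of the growth [eps * u^j / j!] of the density at level [k + j], on a grid of step
    [tau], by induction on [j]. The constants [eps] and [v0] depend on neither [v] nor [k], so
    blocks can be chained. *)
Lemma block (R : realType) (tau lam : R) (M I : nat) : ElliottHalberstam R ->
  0 < lam -> lam < tau -> lam <= 1 ->
  exists eps v0 : R, 0 < eps <= 1 / 2 /\
    forall (v : R) (k : nat), v0 <= v ->
    (forall t, dexp v <= t <= dexp (v + I%:R * tau) ->
       eps * (t / ln t) <= (primes_le t (fun p => k <= H p)%N)%:R) ->
    forall j i t, (j <= M)%N -> (i <= I)%N ->
      dexp (v + i%:R * tau) <= t <= dexp (v + I%:R * tau) ->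
      eps * lam ^+ j * 'C(i - j, j)%:R * (t / ln t) <=
        (primes_le t (fun p => k + j <= H p)%N)%:R.
Proof.
move=> EH lam0 ltlam lam1.
have tau0 : 0 < tau by lra.
pose kap := (tau - lam) / 4.
have kap0 : 0 < kap by rewrite /kap; move: ltlam; clear; lra.
have tau2 : 0 < 2 * tau ^+ 2 by rewrite mulr_gt0 // exprn_gt0.
have B0 : 0 < (2 ^ I)%:R :> R by rewrite ltr0n expn_gt0.
(* Every binomial involved is at most [2 ^ I], so all densities stay at most 1/2 and small enough
   for [block_arith]. *)
pose eps := Num.min (1 / 2) ((tau - lam) / (2 * tau ^+ 2)) / (2 ^ I)%:R.
have mn0 : 0 < Num.min (1 / 2) ((tau - lam) / (2 * tau ^+ 2)).
  by rewrite lt_min; apply/andP; split; [lra|rewrite divr_gt0 //; lra].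
have eps0 : 0 < eps by rewrite divr_gt0.
have epsB : eps * (2 ^ I)%:R = Num.min (1 / 2) ((tau - lam) / (2 * tau ^+ 2)).
  by rewrite divfK // gt_eqF.
have epsB1 : eps * (2 ^ I)%:R <= 1 / 2 by rewrite epsB ge_min lexx.
have epsB2 : 2 * tau ^+ 2 * (eps * (2 ^ I)%:R) <= tau - lam.
  by rewrite mulrC -ler_pdivlMr // epsB ge_min lexx orbT.
have eps1 : eps <= 1 / 2.
  apply: le_trans epsB1; rewrite ler_peMr ?(ltW eps0) // ler1n expn_gt0 //.
clearbody eps; clear epsB mn0.
have lamM0 : 0 < lam ^+ M by rewrite exprn_gt0.
(* A nonzero binomial is at least 1, so a nonzero [A] is at least [eps * lam ^+ M]; the sieve error
   and the window errors, at most [I] of them, are kept below [kap] times this. *)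
pose eta2 := kap * (eps * lam ^+ M).
have eta20 : 0 < eta2 by apply: mulr_gt0 => //; exact: mulr_gt0.
pose eta1 := eta2 / I.+1%:R.
have eta10 : 0 < eta1 by rewrite divr_gt0.
have [v1 Hw] := windows EH eta10.
have d0 : 0 < expR (- (I%:R * tau)) by exact: expR_gt0.
have th1 : expR (- tau) < 1 by rewrite expR_lt1 oppr_lt0.
have [x0 Hs] := near_pinfty_ex (level_step EH d0 th1 eta20).
have [v2 Hv2] := dexp_ge_ex x0.
exists eps, (Num.max v1 v2); split; first by rewrite eps0.
move=> v k; rewrite ge_max => /andP[v1v v2v] base.
have bin_le (i j : nat) : (i <= I)%N -> 'C(i - j, j)%:R <= (2 ^ I)%:R :> R.
  move=> iI; rewrite ler_nat; apply: (@leq_trans (2 ^ (i - j))).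
    have [ji|ij] := leqP j (i - j); last by rewrite bin_small.
    rewrite -[2%N]/(1 + 1)%N expnDn (bigD1 (Ordinal (ji : (j < (i - j).+1)%N))) //=.
    by rewrite !exp1n !muln1 leq_addr.
  by rewrite leq_exp2l // (leq_trans (leq_subr _ _)).
have lamj (j : nat) : (j <= M)%N -> lam ^+ M <= lam ^+ j <= 1.
  by move=> jM; rewrite ler_wiXn2l ?(ltW lam0) // exprn_ile1 ?(ltW lam0).
elim=> [|j IH] i t jM iI tI.
  rewrite expr0 mulr1 bin0 mulr1 addn0; apply: base.
  have /andP[h ->] := tI; rewrite andbT (le_trans _ h) // ler_dexp lerDl.
  by rewrite mulr_ge0 // ltW.
have xge : 1 < t by have /andP[h _] := tI; exact: lt_le_trans (dexp_gt1 _) h.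
have lt0 : 0 < ln t by rewrite ln_gt0.
have X0 : 0 <= t / ln t by rewrite divr_ge0 // ltW // (lt_trans ltr01).
have [C0|] := posnP 'C(i - j.+1, j.+1).
  by rewrite C0 mulr0 mul0r ler0n.
move=> C0; have i1 : (0 < i)%N by case: (i) C0 => //; rewrite sub0n bin0n.
pose A := eps * lam ^+ j * 'C(i - j.+1, j.+1)%:R.
have jM' := ltnW jM.
have /andP[lj0 lj1] := lamj j jM'.
have Ale : A <= eps * (2 ^ I)%:R.
  rewrite /A -mulrA ler_wpM2l ?(ltW eps0) //.
  apply: le_trans (bin_le i j.+1 iI).
  by rewrite ler_piMl.
have Age : eps * lam ^+ M <= A.
  rewrite /A -mulrA ler_wpM2l ?(ltW eps0) //.
  apply: (le_trans lj0); rewrite ler_peMr ?ler1n //.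
  by rewrite exprn_ge0 // ltW.
have A0 : 0 <= A by apply: le_trans Age; rewrite mulr_ge0 ?ltW.
(* The primes [q] stop one window before [t], which keeps [ln q <= expR (- tau) * ln t] with a
   factor below 1. This gap explains the shift by [j] in the binomials. *)
pose N := (Num.truncn (dexp (v + i.-1%:R * tau))).+1.
have W := Hw v tau (fun p => k + j <= H p)%N N
  (fun l => eps * lam ^+ j * 'C(l - j, j)%:R) i.-1 v1v tau0 (truncnS_gt _).
have gle l : (l < i.-1)%N -> 0 <= eps * lam ^+ j * 'C(l - j, j)%:R <= 1.
  move=> li; rewrite !mulr_ge0 ?exprn_ge0 ?(ltW eps0) ?(ltW lam0) //=.
  apply: (@le_trans _ _ (eps * (2 ^ I)%:R)); last first.
    by move: epsB1; clear; lra.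
  rewrite -mulrA ler_wpM2l ?(ltW eps0) //.
  have lI : (l <= I)%N by move: li iI; clear; lia.
  apply: le_trans (bin_le l j lI).
  by rewrite ler_piMl.
have {}W := W gle.
have IHl l s : (l < i.-1)%N ->
    dexp (v + l%:R * tau) <= s <= dexp (v + l.+1%:R * tau) ->
    eps * lam ^+ j * 'C(l - j, j)%:R * (s / ln s) <=
    (primes_le s (fun p => k + j <= H p)%N)%:R.
  move=> li /andP[s1 s2]; apply: IH => //; first by move: li iI; clear; lia.
  rewrite s1 (le_trans s2) // ler_dexp lerD2l ler_wpM2r ?(ltW tau0) //.
  by rewrite ler_nat; move: li iI; clear; lia.
have {}W := W IHl.
have WA : (tau - kap) * A <=
    \sum_(l < i.-1) (eps * lam ^+ j * 'C(l - j, j)%:R * tau - eta1).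
  rewrite sumrB -mulr_suml -mulr_sumr -natr_sum sum_bin_diag.
  rewrite (_ : (i.-1 - j = i - j.+1)%N); last by move: i1; clear; lia.
  rewrite -/A sumr_const card_ord mulrBl [A * _]mulrC lerB //.
  apply: (@le_trans _ _ eta2); last by rewrite /eta2 ler_wpM2l // ltW.
  rewrite -mulr_natr /eta1 mulrAC ler_pdivrMr // ler_wpM2l ?(ltW eta20) //.
  by rewrite ler_nat; move: iI; clear; lia.
have xt : x0 <= t.
  have /andP[h _] := tI; apply: le_trans h; apply: Hv2.
  by rewrite (le_trans v2v) // lerDl mulr_ge0 // ltW.
have m0 : 0 <= (tau - kap) * A by apply: mulr_ge0 => //; rewrite /kap; move: lam0 ltlam; clear; lra.
have mle : (tau - kap) * A <=
    \sum_(q < N | [&& prime q, (k + j <= H q)%N &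
      expR (- (I%:R * tau)) * ln t <= ln q%:R <= expR (- tau) * ln t])
      q.-1%:R^-1.
  apply: (le_trans (le_trans WA W)).
  apply: (@sum_pred_le R N N
    (fun q => [&& prime q, (k + j <= H q)%N
      & dexp v < q%:R <= dexp (v + i.-1%:R * tau)])
    (fun q => [&& prime q, (k + j <= H q)%N &
      expR (- (I%:R * tau)) * ln t <= ln q%:R <= expR (- tau) * ln t])
    (fun q => q.-1%:R^-1)) => q; last by rewrite invr_ge0.
  move=> qN /and4P[pq kq vq qv]; rewrite pq kq qN andbT /=.
  have q0 : 0 < q%:R :> R by rewrite ltr0n prime_gt0.
  have /andP[t1 t2] := tI.
  have t0 : 0 < t by exact: lt_trans xge.
  have lnt1 : expR (v + i%:R * tau) <= ln t.
    by rewrite -ln_dexp ler_ln ?posrE // (lt_trans ltr01) // dexp_gt1.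
  have lnt2 : ln t <= expR (v + I%:R * tau).
    by rewrite -ln_dexp ler_ln ?posrE // (lt_trans ltr01) // dexp_gt1.
  have lnq1 : expR v <= ln q%:R.
    by rewrite -ln_dexp ler_ln ?posrE ?(ltW vq) // (lt_trans ltr01) // dexp_gt1.
  have lnq2 : ln q%:R <= expR (v + i.-1%:R * tau).
    by rewrite -ln_dexp ler_ln ?posrE // (lt_trans ltr01) // dexp_gt1.
  apply/andP; split.
    apply: le_trans lnq1; apply: (le_trans (ler_wpM2l (ltW d0) lnt2)).
    by rewrite -expRD ler_expR addrCA addNr addr0.
  apply: (le_trans lnq2); apply: le_trans (ler_wpM2l (expR_ge0 _) lnt1).
  rewrite -expRD ler_expR -[in leRHS](prednK i1) -natr1; clear; lra.
have st := Hs t xt (k + j)%N N _ m0 mle.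
have -> : (primes_le t (fun p => k + j.+1 <= H p)%N) =
          (primes_le t (fun p => k + j < H p)%N).
  by congr (primes_le t _); apply/funext => p; rewrite addnS.
apply: le_trans st; rewrite ler_wpM2r //.
have -> : eps * lam ^+ j.+1 * 'C(i - j.+1, j.+1)%:R = lam * A.
  by rewrite /A exprS; ring.
apply: block_arith => //; last by rewrite /eta2 ler_wpM2l // ltW.
by apply: le_trans epsB2; rewrite ler_wpM2l // ltW.
Qed.

(** * Choice of the block parameters and iteration over blocks *)

Lemma primepi_ge (R : realType) : ElliottHalberstam R ->
  \forall x \near +oo, 1 / 2 * (x / ln x) <= (primepi x 1 1)%:R :> R.
Proof.
move=> EH; have [C C0 HC] := primepi_EH1 EH.
near=> x.
have x8 : 16 <= x by near: x; apply: nbhs_pinfty_ge; exact: num_real.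
have L1 : 1 <= ln x by near: x; exact: near_ge_ln.
have LC : 4 * C <= ln x by near: x; exact: near_ge_ln.
have /andP[h _] : li x - C * (x / ln x ^+ 2) <= (primepi x 1 1)%:R
      <= li x + C * (x / ln x ^+ 2) by near: x; exact: HC.
have L0 : 0 < ln x by lra.
have xL : 0 <= x / ln x by rewrite divr_ge0 // ltW //; lra.
have l : (x - 2) / ln x <= li x by apply: li_ge; lra.
have e : C * (x / ln x ^+ 2) <= 1 / 4 * (x / ln x).
  have -> : C * (x / ln x ^+ 2) = C / ln x * (x / ln x) by field; rewrite gt_eqF.
  by rewrite ler_wpM2r // ler_pdivrMr //; lra.
have f : 7 / 8 * (x / ln x) <= (x - 2) / ln x.
  by rewrite mulrA ler_wpM2r ?invr_ge0 ?(ltW L0) //; lra.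
lra.
Unshelve. all: by end_near. Qed.

(** Stirling's upper bound, by induction from [ln (1 - 1 / n) <= - 1 / n]. *)
Lemma ln_fact_le (R : realType) (n : nat) : (0 < n)%N ->
  ln n`!%:R <= n%:R * ln n%:R - n%:R + ln n%:R + 1 :> R.
Proof.
case: n => // n _; elim: n => [|n IH].
  by rewrite (_ : 1`! = 1%N) // ln1; lra.
have n1 : 0 < n.+1%:R :> R by rewrite ltr0n.
have n2 : 0 < n.+2%:R :> R by rewrite ltr0n.
rewrite factS natrM lnM ?posrE ?ltr0n ?fact_gt0 //.
have e : n.+1%:R = n.+2%:R * (1 + - n.+2%:R^-1) :> R.
  by rewrite mulrDr mulrN mulfV ?gt_eqF // mulr1 -[in RHS]natr1 addrK.
have p : 0 < 1 + - n.+2%:R^-1 :> R.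
  by rewrite subr_gt0 invf_lt1 // ltr1n.
have l : n.+2%:R * ln (1 + - n.+2%:R^-1) <= -1 :> R.
  have -> : -1 = n.+2%:R * (- n.+2%:R^-1) :> R by rewrite mulrN mulfV ?gt_eqF.
  by rewrite ler_pM2l // le_ln1Dx // ltrN2 invf_lt1 // ltr1n.
have E : ln n.+1%:R = ln n.+2%:R + ln (1 + - n.+2%:R^-1) :> R.
  by rewrite [in LHS]e lnM ?posrE.
move: IH l; rewrite E -[n.+2%:R]natr1.
move: n.+1%:R (ln _) (ln (1 - _)) (ln (n.+1%:R + 1)) => z f b a; clear; nra.
Qed.

Lemma leq_exp_ffact (n m : nat) : ((n - m) ^ m <= n ^_ m)%N.
Proof.
rewrite ffact_prod -{2}[m]card_ord -prod_nat_const; apply: leq_prod => i _.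
by have := ltn_ord i; lia.
Qed.

(** With [I = M * r], bounding the binomial below by [(M (r - 2))^M / M!] and using Stirling makes
    the logarithm of the product at least [M (1 - ln c2 - ln (r / (r - 2))) - ln M - 1]. As
    [c2 < expR 1], this is nonnegative for suitable [r] and [M]. *)
Lemma bin_growth (R : realType) (c : R) : 0 < c -> c < expR 1 ->
  exists (M I : nat) (tau lam : R),
    [/\ 0 < lam, lam < tau, lam <= 1, c * (I%:R * tau) < M%:R
      & 1 <= lam ^+ M * 'C(I - M, M)%:R].
Proof.
move=> c0 ce; pose e : R := expR 1.
have e2 : 2 <= e by have := @expR_ge1Dx R 1; rewrite /e; lra.
(* [c < c1] gives [c * (I * tau) = M * c / c1 < M], and [c1 < c2] gives [lam < tau]. *)
pose c1 := (2 * c + e) / 3; pose c2 := (c + 2 * e) / 3.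
have cc1 : c < c1 by rewrite /c1 /e; lra.
have c12 : c1 < c2 by rewrite /c1 /c2 /e; lra.
have c2e : c2 < e by rewrite /c2 /e; lra.
have c21 : 1 <= c2 by rewrite /c2; lra.
have c10 : 0 < c1 by lra.
have c20 : 0 < c2 by lra.
clearbody c1 c2.
pose del := (1 - ln c2) / 2.
have del0 : 0 < del.
  rewrite divr_gt0 // subr_gt0 -[ltRHS](expRK 1) -/e ltr_ln ?posrE //; lra.
(* Of [1 - ln c2 = 2 * del], one [del] covers [ln (r / a) <= 2 / a]. The other covers [ln M + 1]:
   for [M = n * n], [M * del >= 3 * n] while [ln M <= 2 * n]. *)
pose a := (Num.truncn (2 / del)).+1.
pose n := (Num.truncn (3 / del)).+1.
have ha : 2 / del < a%:R by exact: truncnS_gt.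
have hn : 3 / del < n%:R by exact: truncnS_gt.
have a0 : 0 < a%:R :> R by rewrite ltr0n.
have n0 : 0 < n%:R :> R by rewrite ltr0n.
have n1 : 1 <= n%:R :> R by rewrite ler1n.
move: a n ha hn a0 n0 n1 => a n ha hn a0 n0 n1.
pose r := (a + 2)%N; pose M := (n * n)%N.
have rN : r = (a + 2)%N by [].
have ME : M = (n * n)%N by [].
clearbody r M.
have r0 : 0 < r%:R :> R by rewrite ltr0n rN addn2.
have rE : r%:R = a%:R + 2 :> R by rewrite rN natrD.
have r1 : 1 <= r%:R :> R by rewrite rE; lra.
have n00 : (0 < n)%N by move: n0; rewrite ltr0n.
have a00 : (0 < a)%N by move: a0; rewrite ltr0n.
have M0 : (0 < M)%N by rewrite ME muln_gt0 n00.
have MR0 : 0 < M%:R :> R by rewrite ltr0n.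
exists M, (M * r)%N, (r%:R * c1)^-1, (r%:R * c2)^-1.
have rc1 : 0 < r%:R * c1 by rewrite mulr_gt0.
have rc2 : 0 < r%:R * c2 by rewrite mulr_gt0.
split.
- by rewrite invr_gt0.
- by rewrite ltf_pV2 ?posrE // ltr_pM2l.
- by rewrite invf_le1 // -[leLHS]mul1r ler_pM.
- have -> : c * ((M * r)%:R * (r%:R * c1)^-1) = M%:R * (c / c1).
    by rewrite natrM; field; rewrite !gt_eqF.
  by rewrite gtr_pMr // ltr_pdivrMr // mul1r.
have lowR : ((M * a) ^ M)%:R / M`!%:R <= 'C(M * r - M, M)%:R :> R.
  rewrite ler_pdivrMr ?ltr0n ?fact_gt0 // -natrM ler_nat bin_ffact.
  have -> : (M * a = (M * r - M) - M)%N by rewrite rN mulnDr muln2 -addnn addnA !addnK.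
  exact: leq_exp_ffact.
have lamM : 0 <= (r%:R * c2)^-1 ^+ M by rewrite exprn_ge0 // invr_ge0 ltW.
apply: le_trans (ler_wpM2l lamM lowR).
have Ma : 0 < (M * a)%:R :> R by rewrite ltr0n muln_gt0 M0.
have fM : 0 < M`!%:R :> R by rewrite ltr0n fact_gt0.
rewrite -[leLHS]expR0 -ler_ln ?posrE ?expR_gt0 //; last first.
  by rewrite mulr_gt0 ?divr_gt0 ?exprn_gt0 ?invr_gt0 // ltr0n expn_gt0 muln_gt0 M0 a00.
rewrite expRK lnM ?posrE ?exprn_gt0 ?invr_gt0 //; last first.
  by rewrite divr_gt0 // ltr0n expn_gt0 muln_gt0 M0 a00.
have lnXM (z : R) : 0 < z -> ln (z ^+ M) = M%:R * ln z.
  by move=> z0; rewrite lnXn // mulr_natl.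
rewrite lnXM ?invr_gt0 // lnV ?posrE // lnM ?posrE //.
rewrite ln_div ?posrE // ?ltr0n ?expn_gt0 ?muln_gt0 ?M0 ?a00 //.
rewrite natrX lnXM // natrM lnM ?posrE //.
have F := @ln_fact_le R M M0.
have lM : ln M%:R <= 2 * n%:R :> R.
  rewrite ME natrM lnM ?posrE //; have := ln_sublinear n0; move: (ln _) => z.
  by clear; lra.
have lr : ln r%:R <= ln a%:R + del.
  have -> : r%:R = a%:R * (1 + 2 / a%:R) :> R by rewrite rE; field; rewrite gt_eqF.
  have p : 0 < 2 / a%:R :> R by rewrite divr_gt0.
  have q : 0 < 1 + 2 / a%:R :> R by apply: addr_gt0.
  rewrite lnM ?posrE //.
  rewrite lerD2l; apply: (@le_trans _ _ (2 / a%:R)).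
    by apply: le_ln1Dx; apply: lt_trans p; rewrite ltrN10.
  rewrite ler_pdivrMr // mulrC; move: ha; rewrite ltr_pdivrMr // => /ltW.
  by rewrite mulrC.
have Md : 2 * n%:R + 1 <= M%:R * del.
  move: hn; rewrite ltr_pdivrMr // => hn; rewrite ME natrM.
  have : n%:R * 3 <= n%:R * (n%:R * del) by rewrite ler_wpM2l ?(ltW n0) // ltW.
  by move: n1; clear; lra.
have lc : ln c2 = 1 - 2 * del by rewrite /del; field.
rewrite lc.
have K : M%:R * ln r%:R <= M%:R * (ln a%:R + del) by rewrite ler_wpM2l // ltW.
move: K Md lM F; clear.
move: M%:R (ln r%:R) (ln a%:R) (ln M%:R) (ln M`!%:R) => m u v w f; lra.
Qed.

(** By [bin_growth] a block raises the level by [M] and ends with density at least the same [eps],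
    so the next block can start. The first one starts from level 0, where [primepi_ge] and
    [eps <= 1 / 2] suffice. *)
Lemma block_iter (R : realType) (c : R) : ElliottHalberstam R ->
  0 < c -> c < expR 1 ->
  exists (M : nat) (w eps u0 : R), [/\ 0 < w, c * w < M%:R, 0 < eps <= 1 &
    forall (K : nat) t, dexp (u0 + K%:R * w) <= t ->
      eps * (t / ln t) <= (primes_le t (fun p => K * M <= H p)%N)%:R].
Proof.
move=> EH c0 ce; have [M [I [tau [lam [lam0 lt lam1 cM big]]]]] := bin_growth c0 ce.
have [eps [v0 [/andP[eps0 eps1] B]]] := block M I EH lam0 lt lam1.
have [x0 Hx] := near_pinfty_ex (primepi_ge EH).
have [v1 Hv] := dexp_ge_ex x0.
have tau0 : 0 < tau := lt_trans lam0 lt.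
have I0 : (0 < I)%N.
  case: (I) (M) big cM => // -[|m]; last by rewrite sub0n bin0n mulr0 ler10.
  by rewrite mul0r mulr0 ltxx.
pose u0 := Num.max v0 v1.
exists M, (I%:R * tau), eps, u0; split => //.
- by rewrite mulr_gt0 // ltr0n.
- by rewrite eps0 (le_trans eps1) //; clear; lra.
have w0 : 0 < I%:R * tau by rewrite mulr_gt0 // ltr0n.
elim=> [|K IH] t tu.
  have xt : x0 <= t.
    by apply: le_trans tu; apply: Hv; rewrite mul0r addr0 /u0 le_max lexx orbT.
  have t1 : 1 < t by apply: lt_le_trans tu; exact: dexp_gt1.
  have X0 : 0 <= t / ln t.
    by rewrite divr_ge0 ?ln_ge0 // ltW // (lt_trans ltr01).
  apply: le_trans (ler_wpM2r X0 eps1) _; apply: le_trans (Hx t xt) _.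
  by apply: primes_le_mono => p _ _; rewrite mul0n.
have t1 : 1 < t by apply: lt_le_trans tu; exact: dexp_gt1.
(* The block is placed so that [t] is its right end. *)
pose v := ln (ln t) - I%:R * tau.
have tE : t = dexp (v + I%:R * tau) by rewrite /v subrK lnK_dexp.
have vu : u0 + K%:R * (I%:R * tau) <= v.
  move: tu; rewrite {1}tE ler_dexp -natr1 mulrDl mul1r addrA lerD2r.
  by [].
have v0v : v0 <= v.
  apply: le_trans vu; rewrite /u0; apply: (@le_trans _ _ (Num.max v0 v1)).
    by rewrite le_max lexx.
  by rewrite lerDl mulr_ge0 // ltW.
have base s : dexp v <= s <= dexp (v + I%:R * tau) ->
    eps * (s / ln s) <= (primes_le s (fun p => K * M <= H p)%N)%:R.
  by move=> /andP[vs _]; apply: IH; apply: le_trans vs; rewrite ler_dexp.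
have := B v (K * M)%N v0v base M I t (leqnn M) (leqnn I).
rewrite -tE lexx => /(_ isT); rewrite mulSn addnC; apply: le_trans.
have X0 : 0 <= t / ln t by rewrite divr_ge0 ?ln_ge0 // ltW // (lt_trans ltr01).
by rewrite ler_wpM2r // -mulrA ler_peMr // ltW.
Qed.

(** * Almost all primes *)

Lemma primes_le_split (R : realType) (x : R) (P : nat -> bool) :
  (primes_le x P)%:R + (primes_le x (fun p => ~~ P p))%:R
  = (primepi x 1 1)%:R :> R.
Proof.
rewrite primepi_eq !natr_primes_le -big_split /=; apply: eq_bigr => p _.
by rewrite !modn1 eqxx; case: (P p); rewrite ?addr0 ?add0r.
Qed.

(** For [q] and [r] up to [x^(1/4)] the products stay below [x^(1/2)]: at level 1/2 there are no bad
    pairs, and [1 - m / (1 + m) = 1 / (1 + m)]. *)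
Lemma few_survivors (R : realType) : ElliottHalberstam R ->
  exists2 C : R, 0 < C & \forall x \near +oo, forall (S : pred nat) (n : nat) (m : R),
    (forall q, S q -> prime q && (ln q%:R <= ln x / 4)) ->
    0 <= m -> m <= \sum_(q < n | S q) q.-1%:R^-1 ->
    (primes_le x (fun p => ~~ `[< exists2 q, S q & (p == 1 %[mod q])%N >]))%:R
    <= 6 * (x / ln x) / (1 + m) + C * (x / ln x ^+ 2).
Proof.
move=> EH; have half1 : 1 / 2 < 1 :> R by lra.
have [C1 C10 HC1] := EH_sum_le EH half1; have [C2 C20 HC2] := primepi_EH1 EH.
exists (5 * C1 + C2); first by lra.
near=> x => S n m HS m0 mle.
have x5 : 5 <= x by near: x; apply: nbhs_pinfty_ge; exact: num_real.
have /andP[_ pile] : li x - C2 * (x / ln x ^+ 2) <= (primepi x 1 1)%:R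
      <= li x + C2 * (x / ln x ^+ 2) by near: x; exact: HC2.
have EC : \sum_(1 <= m < (Num.truncn (x `^ (1 / 2))).+1) EH_error x m
      <= C1 * (x / ln x ^+ 2) by near: x; exact: HC1.
move: EC; set Q := Num.truncn _ => EC.
have x0 : 0 < x by lra.
have y0 : 0 < x `^ (1 / 2) by exact: powR_gt0.
have Spr q : S q -> prime q by move=> /HS /andP[].
have L0 : 0 < ln x by rewrite ln_gt0 //; lra.
have leQ (k : nat) : (0 < k)%N -> ln k%:R <= 1 / 2 * ln x -> (k <= Q)%N.
  move=> k0 kle; rewrite truncn_ge_nat ?(ltW y0) //.
  by rewrite -ler_ln ?posrE ?ltr0n // ln_powR.
have SQ q : S q -> (q < Q.+1)%N.
  move=> Sq; have /andP[pq le] := HS q Sq; rewrite ltnS leQ ?prime_gt0 //.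
  by move: le L0; clear; lra.
have SSQ q r : S q -> S r -> (q * r <= Q)%N.
  move=> Sq Sr; have /andP[pq leq] := HS q Sq; have /andP[pr ler] := HS r Sr.
  rewrite leQ ?muln_gt0 ?prime_gt0 // natrM lnM ?posrE ?ltr0n ?prime_gt0 //.
  by move: leq ler; clear; lra.
have B0 : bad_pairs x Q S (fun=> 1) = 0.
  apply: big1 => q Sq; apply: big_pred0 => r.
  apply/negbTE/negP => /and3P[Sr _]; rewrite ltnNge => /negP; apply.
  exact: SSQ.
have li0 : 0 <= li x by apply: li_ge0; lra.
pose M : R := \sum_(q < Q.+1 | S q) q.-1%:R^-1.
have mM : m <= M.
  apply: (le_trans mle).
  apply: (@sum_pred_le _ _ _ S S (fun q => q.-1%:R^-1)) => q.
    by move=> _ Sq; rewrite Sq SQ.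
  by rewrite invr_ge0.
have G := @sieve_ge R x Q S M Spr li0 erefl; rewrite B0 in G.
have ccc : (primes_le x (fun p => [exists q : 'I_Q.+1, S q && (p == 1 %[mod q])%N]))%:R <=
   (primes_le x (fun p => `[< exists2 q, S q & (p == 1 %[mod q])%N >]))%:R :> R.
  apply: primes_le_mono => p pp /existsP[q /andP[Sq e]].
  by apply/asboolP; exists q.
have sp := primes_le_split x (fun p => `[< exists2 q, S q & (p == 1 %[mod q])%N >]).
have M1 : 0 < 1 + M by move: m0 mM; clear; lra.
have e1 : li x - li x * (M / (1 + M)) = li x / (1 + M) by field; rewrite gt_eqF.
have e2 : li x / (1 + M) <= li x / (1 + m).
  rewrite ler_wpM2l // lef_pV2 ?posrE ?lerD2l //.
  by move: m0; clear; lra.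
have e3 : li x / (1 + m) <= 6 * (x / ln x) / (1 + m).
  rewrite ler_wpM2r ?invr_ge0 ?addr_ge0 //.
  by apply: li_le; move: x5; clear; lra.
move: G ccc sp e1 e2 e3 pile EC; clear.
move: (x / _ ^+ _) (primepi x 1 1)%:R (primes_le x _)%:R (primes_le x _)%:R (primes_le x _)%:R.
move: (_ / (1 + m)) (_ / (1 + m)) (li x / _) (li x * _) (\sum_(1 <= _ < _) _) => a b c d e.
by move=> f g h i j; lra.
Unshelve. all: by end_near. Qed.

Lemma near_ge_lnln (R : realType) (M : R) : \forall x \near +oo, M <= ln (ln x).
Proof.
near=> x; have h : expR M <= ln x by near: x; exact: near_ge_ln.
rewrite -(expRK M) ler_ln ?posrE ?expR_gt0 //.
exact: lt_le_trans (expR_gt0 M) h.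
Unshelve. all: by end_near. Qed.

(** The primes below 4 are set aside: from 4 on, [ln ln p >= 0], so that [c] may be replaced by a
    larger constant. *)
Lemma sum_lt4 (R : realType) (n : nat) :
  \sum_(p < n | prime p) (p < 4)%N%:R <= 4 :> R.
Proof.
have -> : \sum_(p < n | prime p) (p < 4)%N%:R =
    \sum_(p < n | prime p && (p < 4)%N) 1 :> R.
  by rewrite [RHS]big_mkcondr; apply: eq_bigr => p _; case: ifP.
have -> : 4 = \sum_(p < 4 | true) 1 :> R by rewrite sumr_const card_ord.
by apply: (@sum_pred_le R n 4 (fun p => prime p && (p < 4)%N) predT (fun=> 1)) => // p _ /andP[].
Qed.

Lemma lnln_ge0 (R : realType) (p : nat) : (4 <= p)%N -> 0 <= ln (ln p%:R) :> R.
Proof.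
move=> p4; apply: ln_ge0; apply: (@le_trans _ _ (ln 4%:R)).
  have -> : 4%:R = 2 * 2 :> R by rewrite -natrM.
  by rewrite lnM ?posrE //; have := ln2_ge R; move: (ln 2) => z; clear; lra.
by rewrite ler_ln ?posrE ?ltr0n ?ler_nat //; apply: leq_trans p4.
Qed.

Theorem corollary1 (R : realType) (EH : ElliottHalberstam R)
    (c : R) (hc : c < expR 1) :
  @almost_all_primes R (fun p : nat => c * ln (ln p%:R) < (H p)%:R).
Proof.
pose c0 := Num.max c 1.
have e1 : 1 < expR 1 :> R by rewrite expR_gt1.
have c00 : 0 < c0 by rewrite lt_max ltr01 orbT.
have c0e : c0 < expR 1 by rewrite gt_max hc e1.
have cc0 : c <= c0 by rewrite le_max lexx.
have [M [w [eps [u0 [w0 cM /andP[eps0 eps1] It]]]]] := block_iter EH c00 c0e.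
clearbody c0.
have M0 : 0 < M%:R :> R by apply: lt_trans cM; rewrite mulr_gt0.
have [y0 Hy] := near_pinfty_ex (window EH (@ltr01 R)).
have [v1 Hv] := dexp_ge_ex y0.
have [C C0 HC] := few_survivors EH.
pose u1 := Num.max (Num.max u0 v1) 0.
have u0u1 : u0 <= u1 by rewrite !le_max lexx.
have v1u1 : v1 <= u1 by rewrite !le_max lexx orbT.
have u10 : 0 <= u1 by rewrite le_max lexx orbT.
clearbody u1.
(* Level [K * M], about [c0 * u], is reached at time [(1 - rho) * u + O(1)], so a window of length
   about [rho * u] is left below [x^(1/4)]. The 2 in [B] covers [ln 4]. *)
pose rho := 1 - c0 * w / M%:R.
have rho0 : 0 < rho by rewrite subr_gt0 ltr_pdivrMr // mul1r.
pose B := u1 + w + 2.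
apply/cvgrPdist_le => e e0.
near=> x.
have x5 : 5 <= x by near: x; apply: nbhs_pinfty_ge; exact: num_real.
have u0' : 1 <= ln (ln x) by near: x; exact: near_ge_lnln.
(* The target is [m = 18 / e], for which [6 / (1 + m) <= e / 3]; the added 1 is the error in
   [window], and [eps] is the density of usable primes. *)
have uB : (B + (18 / e + 1) / eps) / rho <= ln (ln x).
  by near: x; exact: near_ge_lnln.
have L1 : 1 <= ln x by near: x; exact: near_ge_ln.
have LC : 3 * C / e <= ln x by near: x; exact: near_ge_ln.
have Le : 24 / e <= ln x by near: x; exact: near_ge_ln.
have surv : forall (S : pred nat) (n : nat) (m : R),
    (forall q, S q -> prime q && (ln q%:R <= ln x / 4)) ->
    0 <= m -> m <= \sum_(q < n | S q) q.-1%:R^-1 ->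
    (primes_le x (fun p => ~~ `[< exists2 q, S q & (p == 1 %[mod q])%N >]))%:R
    <= 6 * (x / ln x) / (1 + m) + C * (x / ln x ^+ 2).
  by near: x; exact: HC.
set L := ln x in u0' uB L1 LC Le surv *.
set u := ln L in u0' uB.
have L0 : 0 < L by exact: lt_le_trans L1.
have x0 : 0 < x by apply: lt_le_trans x5.
have uL : expR u = L by rewrite lnK // posrE.
pose K := (Num.truncn (c0 * u / M%:R)).+1.
have u00 : 0 <= u by exact: le_trans u0'.
have KM0 : 0 <= c0 * u / M%:R by rewrite !mulr_ge0 ?invr_ge0 // ltW.
have /andP[Klo Khi] : K%:R - 1 <= c0 * u / M%:R < K%:R.
  by rewrite /K -natr1 addrK natr1 truncn_itv.
clearbody K.
have KMu : c0 * u <= (K * M)%:R.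
  by rewrite natrM -ler_pdivrMr // ltW.
pose v := u1 + K%:R * w.
have vle : v <= (1 - rho) * u + B - 2.
  have h : K%:R * w <= (c0 * u / M%:R + 1) * w.
    by rewrite ler_wpM2r ?(ltW w0) // -lerBlDr.
  rewrite /v /B /rho; apply: le_trans (_ : u1 + (c0 * u / M%:R + 1) * w <= _).
    by rewrite lerD2l.
  by rewrite le_eqVlt; apply/orP; left; apply/eqP; field; rewrite gt_eqF.
have uB' : B + (18 / e + 1) / eps <= rho * u by rewrite [rho * u]mulrC -ler_pdivrMr.
have e18 : 0 < 18 / e by rewrite divr_gt0.
have mpos : 0 < (18 / e + 1) / eps.
  by rewrite divr_gt0 // addr_gt0.
pose z := expR (L / 4).
have z1 : 1 < z by rewrite /z expR_gt1 divr_gt0.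
have lnz : ln z = L / 4 by rewrite expRK.
have lnlnz : u - 2 <= ln (ln z).
  rewrite lnz ln_div ?posrE //.
  have -> : 4 = 2 * 2 :> R by rewrite -natrM.
  rewrite lnM ?posrE //; have := ln2_le1 R; rewrite -/u; move: (ln 2) => s.
  by clear; lra.
have vz : v <= ln (ln z).
  by apply: le_trans lnlnz; move: vle uB' mpos; clear; lra.
have dvz : dexp v <= z by rewrite -(lnK_dexp z1) ler_dexp.
pose S : pred nat := fun q => [&& prime q, (K * M <= H q)%N & dexp v < q%:R <= z].
pose N := (Num.truncn z).+1.
have dv : y0 <= dexp v.
  by apply: Hv; rewrite (le_trans v1u1) // lerDl mulr_ge0 // ltW.
have W : eps * (ln (ln z) - ln (ln (dexp v))) - 1 <= \sum_(q < N | S q) q.-1%:R^-1.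
  apply: (Hy (dexp v) dv z eps (fun q => K * M <= H q)%N N dvz (truncnS_gt z)).
    by rewrite (ltW eps0).
  move=> t /andP[vt _]; apply: It; apply: le_trans vt.
  by rewrite ler_dexp lerD2r.
rewrite dexpK in W.
have mle : 18 / e <= \sum_(q < N | S q) q.-1%:R^-1.
  apply: le_trans W; rewrite lerBrDr [eps * _]mulrC -ler_pdivrMr //.
  by move: vle lnlnz uB'; clear; lra.
have HS q : S q -> prime q && (ln q%:R <= L / 4).
  move=> /and4P[pq _ _ qz]; rewrite pq /= -lnz ler_ln ?posrE ?ltr0n ?prime_gt0 //.
  exact: lt_trans z1.
have {surv}F := surv S N (18 / e) HS (ltW e18) mle.
have X0 : 0 < x / L by rewrite divr_gt0.
set f : R := (primes_le x (fun p => ~~ `[< c * ln (ln p%:R) < (H p)%:R >]))%:R.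
suff fle : f <= e * (x / L).
  have f0 : 0 <= f / (x / L) by apply: divr_ge0; [exact: ler0n|exact: ltW].
  by rewrite sub0r normrN (ger0_norm f0) ler_pdivrMr.
(* A prime [p >= 4] congruent to 1 modulo some [q] in [S] has
   [H p > K * M >= c0 * u >= c * ln ln p], so the exceptional primes are survivors of the sieve or
   below 4. *)
have f4 : f <= 6 * (x / L) / (1 + 18 / e) + C * (x / L ^+ 2) + 4.
  apply: le_trans (lerD F (sum_lt4 R (Num.truncn x).+1)).
  rewrite /f !natr_primes_le -big_split /=; apply: ler_sum => p pp.
  case: (ltnP p 4) => p4.
    by apply: (@le_trans _ _ 1); rewrite ?lerDr ?ler0n // lern1 leq_b1.
  rewrite addr0 ler_nat; case: asboolP => //= nH; case: asboolP => //= -[q Sq qp].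
  case: nH; have /and4P[pq kq _ _] := Sq.
  have kp : (K * M < H p)%N := H_step pp pq qp kq.
  have lp0 : 0 <= ln (ln p%:R) :> R by exact: lnln_ge0.
  have px : p%:R <= x by rewrite -truncn_ge_nat ?(ltW x0) // -ltnS.
  have lp : ln (ln p%:R) <= u.
    have pr0 : 0 < p%:R :> R by rewrite ltr0n prime_gt0.
    have lpx : ln p%:R <= L by rewrite ler_ln ?posrE.
    have lp1 : 0 < ln p%:R :> R by rewrite ln_gt0 // ltr1n prime_gt1.
    by rewrite ler_ln ?posrE.
  apply: le_lt_trans (_ : (K * M)%:R < _); last by rewrite ltr_nat.
  apply: le_trans KMu; apply: (@le_trans _ _ (c0 * ln (ln p%:R))).
    by rewrite ler_wpM2r.
  by rewrite ler_wpM2l // ltW.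
have t1 : 6 * (x / L) / (1 + 18 / e) <= e / 3 * (x / L).
  rewrite mulrAC ler_wpM2r ?(ltW X0) // ler_pdivrMr; last by rewrite addr_gt0.
  have -> : e / 3 * (1 + 18 / e) = e / 3 + 6 by field; rewrite gt_eqF.
  by move: e0; clear; lra.
have t2 : C * (x / L ^+ 2) <= e / 3 * (x / L).
  have -> : C * (x / L ^+ 2) = C / L * (x / L) by field; rewrite gt_eqF.
  rewrite ler_wpM2r ?(ltW X0) // ler_pdivrMr //.
  by move: LC; rewrite ler_pdivrMr //; clear; lra.
(* From [expR L >= L ^+ 2 / 2] one gets [x / L >= L / 2], and [L >= 24 / e]. *)
have t3 : 4 <= e / 3 * (x / L).
  have xL : L / 2 <= x / L.
    rewrite ler_pdivlMr // -(lnK (_ : x \in Num.pos)) ?posrE // -/L.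
    have := @expR_ge1Dxn R L 1 (ltW L0); rewrite !factS fact0 expr2.
    by move: (expR L) => s; clear; lra.
  apply: le_trans (ler_wpM2l _ xL); last by rewrite divr_ge0 // ltW.
  by move: Le; rewrite ler_pdivrMr //; clear; lra.
move: f4 t1 t2 t3; clear; move: (x / L) (_ / (1 + 18 / e)) (C * _) => d a b; lra.
Unshelve. all: by end_near. Qed.
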